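(* Let $n\ge 3$. (a) Let $\mathcal M^n\subset\mathbb R^{n+1}$ be a minimal hypersurface of the class $\mathcal K_0$. Then every (connected) integral surface of its distribution $\Delta$ is a minimal surface in a three-dimensional affine subspace $\mathbb R^3\subset\mathbb R^{n+1}$ or a minimal surface in a three-dimensional round sphere $\mathbb S^3(r)$, of some radius $r>0$, contained in a four-dimensional affine subspace of $\mathbb R^{n+1}$. (b) Conversely, any minimal surface $\mathcal M^2$, without points at which its second fundamental form vanishes, in a three-dimensional affine subspace $\mathbb R^3\subset\mathbb R^{n+1}$ or in a three-dimensional round sphere $\mathbb S^3(r)\subset\mathbb R^{n+1}$, generates a minimal hypersurface of the class $\mathcal K_0$; that is, the hypersurface $$X(u,v;w^1,\dots,w^{n-2})=z(u,v)+\sum_{\alpha=1}^{n-2}w^\alpha b_\alpha(u,v),\qquad (u,v)\in\mathcal D,\ w^\alpha\in\mathbb R,$$ generated by $\mathcal M^2:\ z=z(u,v)$, $(u,v)\in\mathcal D$, is, where this map is an immersion, a minimal hypersurface of the class $\mathcal K_0$.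
   Context: Considerations are local and all objects are smooth. A regular hypersurface $\mathcal M^n$ in Euclidean space $\mathbb R^{n+1}$ ($n\ge3$) is of type number two if at each point its shape operator has two nonzero eigenvalues $\nu_1,\nu_2$ (counted with multiplicity; $\nu_1\nu_2\neq0$) and the other $n-2$ eigenvalues are zero. $\Delta$ denotes the two-dimensional distribution on $\mathcal M^n$ spanned by unit (orthogonal) eigenvector fields $X,Y$ corresponding to $\nu_1,\nu_2$, i.e. the orthogonal complement in the tangent spaces of the kernel of the shape operator. $\mathcal K_0$ is the class of hypersurfaces of type number two whose distribution $\Delta$ is involutive. A hypersurface of type number two is minimal if $\nu_1+\nu_2=0$. An integral surface of $\Delta$ is a two-dimensional surface in $\mathcal M^n$ whose tangent plane at each point is the corresponding plane of $\Delta$. Generated hypersurface: let $\mathcal M^2:\ z=z(u,v)$, $(u,v)\in\mathcal D$, be a surface in $\mathbb R^3$ or in $\mathbb S^3(r)$, where $\mathbb R^3$ is a three-dimensional affine subspace of $\mathbb R^{n+1}$ and $\mathbb S^3(r)$ is a round 3-sphere of radius $r$ in a four-dimensional affine subspace of $\mathbb R^{n+1}$. Let $N$ be the unit normal field of $\mathcal M^2$ in $\mathbb R^3$, respectively in $\mathbb S^3(r)$. At each $(u,v)$ let $\{b_1(u,v),\dots,b_{n-2}(u,v)\}$ be a (smooth) basis of the orthogonal complement in $\mathbb R^{n+1}$ of $\mathrm{span}\{z_u,z_v,N\}$; in the case of $\mathbb R^3$ the $b_\alpha$ are taken to be a constant orthonormal basis of the orthogonal complement of $\mathbb R^3$. ''Second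 fundamental form'' of $\mathcal M^2$ means that of $\mathcal M^2$ in $\mathbb R^3$, respectively in $\mathbb S^3(r)$, with respect to $N$. *)

(* Defs.v *)
From mathcomp Require Import all_boot all_order all_algebra.
From mathcomp Require Import all_classical all_reals all_analysis.

Set Implicit Arguments.
Unset Strict Implicit.
Unset Printing Implicit Defensive.

Import Order.TTheory GRing.Theory Num.Theory.
Import numFieldNormedType.Exports.

Local Open Scope classical_set_scope.
Local Open Scope ring_scope.

(* Vectors are rows: [jacobian X x] has as i-th row the partial derivative of X
   along the i-th coordinate, and the differential of X at x is
   [v |-> v *m jacobian X x].  Submanifolds are given by immersed patches
   X : U -> R^d with U open in R^m; a tangent vector at X x is represented by
   its coordinate vector v : 'rV_m, the actual vector being
   [v *m jacobian X x]. *)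

Definition dot (R : realType) d (u v : 'rV[R]_d) : R :=
  \sum_(i < d) u 0 i * v 0 i.

Fixpoint Ck (R : realType) (V W : normedModType R) (k : nat)
    (U : set V) (f : V -> W) : Prop :=
  match k with
  | 0 => forall x, U x -> {for x, continuous f}
  | k'.+1 => (forall x, U x -> differentiable f x) /\
             (forall v, Ck k' U ('D_v f))
  end.

(* Used only for open U. *)
Definition smooth_on (R : realType) (V W : normedModType R)
    (U : set V) (f : V -> W) : Prop := forall k, Ck k U f.

Definition regular_patch (R : realType) m d
    (U : set 'rV[R]_m) (X : 'rV[R]_m -> 'rV[R]_d) : Prop :=
  [/\ open U, smooth_on U X & forall x, U x -> row_free (jacobian X x)].

(* A unit normal field along X inside an ambient submanifold of R^d whose
   tangent space at p is [T p]. *)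
Definition unit_normal (R : realType) m d (T : 'rV[R]_d -> set 'rV[R]_d)
    (U : set 'rV[R]_m) (X N : 'rV[R]_m -> 'rV[R]_d) : Prop :=
  smooth_on U N /\
  forall x, U x ->
    [/\ T (X x) (N x), dot (N x) (N x) = 1 &
        forall v, dot (v *m jacobian X x) (N x) = 0].

Definition first_ff (R : realType) m d (X : 'rV[R]_m -> 'rV[R]_d)
    (x : 'rV[R]_m) : 'M[R]_m :=
  \matrix_(i, j) dot ('D_('e_i) X x) ('D_('e_j) X x).

Definition second_ff (R : realType) m d (X N : 'rV[R]_m -> 'rV[R]_d)
    (x : 'rV[R]_m) : 'M[R]_m :=
  \matrix_(i, j) dot ('D_('e_j) ('D_('e_i) X) x) (N x).

(* Acts on coordinate vectors by [v |-> v *m shape_op X N x]; this is the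
   Weingarten map: dN(v) = - dX(v *m shape_op X N x). *)
Definition shape_op (R : realType) m d (X N : 'rV[R]_m -> 'rV[R]_d)
    (x : 'rV[R]_m) : 'M[R]_m :=
  second_ff X N x *m invmx (first_ff X x).

(* nu1, nu2 are nonzero and, with the eigenvalue 0 taken m - 2 times, they are
   all the eigenvalues of S with multiplicity. *)
Definition type_two_eigenvalues (R : realType) m (S : 'M[R]_m) (nu1 nu2 : R)
    : Prop :=
  [/\ nu1 != 0, nu2 != 0 &
      char_poly S = ('X - nu1%:P) * ('X - nu2%:P) * 'X^(m - 2)].

(* Here and below the dimension d of the ambient space of a hypersurface is
   m + 1; it is kept as a separate parameter to avoid casts. *)
Definition type_number_two (R : realType) m d
    (U : set 'rV[R]_m) (X N : 'rV[R]_m -> 'rV[R]_d) : Prop :=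
  [/\ regular_patch U X, unit_normal (fun=> setT) U X N &
      forall x, U x ->
        exists nu1 nu2, type_two_eigenvalues (shape_op X N x) nu1 nu2].

(* Orthogonal complement, in the tangent space, of the kernel of the shape
   operator. *)
Definition Delta (R : realType) m d (X N : 'rV[R]_m -> 'rV[R]_d)
    (x : 'rV[R]_m) : set 'rV[R]_m :=
  [set v | forall w, w *m shape_op X N x = 0 ->
     dot (v *m jacobian X x) (w *m jacobian X x) = 0].

Definition lie_bracket (R : realType) m (A B : 'rV[R]_m -> 'rV[R]_m)
    (x : 'rV[R]_m) : 'rV[R]_m :=
  'D_(A x) B x - 'D_(B x) A x.

Definition involutive_on (R : realType) m
    (U : set 'rV[R]_m) (P : 'rV[R]_m -> set 'rV[R]_m) : Prop :=
  forall (O : set 'rV[R]_m) (A B : 'rV[R]_m -> 'rV[R]_m),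
    open O -> O `<=` U -> smooth_on O A -> smooth_on O B ->
    (forall x, O x -> P x (A x)) -> (forall x, O x -> P x (B x)) ->
    forall x, O x -> P x (lie_bracket A B x).

Definition class_K0 (R : realType) m d
    (U : set 'rV[R]_m) (X N : 'rV[R]_m -> 'rV[R]_d) : Prop :=
  type_number_two U X N /\ involutive_on U (Delta X N).

Definition minimal_type_two (R : realType) m d
    (U : set 'rV[R]_m) (X N : 'rV[R]_m -> 'rV[R]_d) : Prop :=
  forall x nu1 nu2, U x -> type_two_eigenvalues (shape_op X N x) nu1 nu2 ->
    nu1 + nu2 = 0.

(* The surface is [X \o phi], a surface in the hypersurface X. *)
Definition integral_surface (R : realType) m d
    (U : set 'rV[R]_m) (X N : 'rV[R]_m -> 'rV[R]_d)
    (D : set 'rV[R]_2) (phi : 'rV[R]_2 -> 'rV[R]_m) : Prop :=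
  [/\ regular_patch D phi, forall q, D q -> U (phi q) &
      forall q, D q -> forall v,
        (v <= jacobian phi q)%MS <-> Delta X N (phi q) v].

Definition affine_space (R : realType) k d (c : 'rV[R]_d) (E : 'M[R]_(k, d))
    : set 'rV[R]_d :=
  [set p | (p - c <= E)%MS].

Definition round_sphere (R : realType) k d (c : 'rV[R]_d) (E : 'M[R]_(k, d))
    (r : R) : set 'rV[R]_d :=
  [set p | affine_space c E p /\ dot (p - c) (p - c) = r ^+ 2].

Definition round_sphere_tangent (R : realType) k d (c : 'rV[R]_d)
    (E : 'M[R]_(k, d)) (p : 'rV[R]_d) : set 'rV[R]_d :=
  [set t | (t <= E)%MS /\ dot t (p - c) = 0].

(* A surface z with unit normal N, minimal in the three-dimensional ambient
   submanifold M of R^d whose tangent space at p is [T p]. *)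
Definition minimal_surface_in (R : realType) d
    (M : set 'rV[R]_d) (T : 'rV[R]_d -> set 'rV[R]_d)
    (D : set 'rV[R]_2) (z N : 'rV[R]_2 -> 'rV[R]_d) : Prop :=
  [/\ regular_patch D z, forall q, D q -> M (z q), unit_normal T D z N &
      forall q, D q -> \tr (shape_op z N q) = 0].

Definition minimal_in_affine3 (R : realType) d
    (c : 'rV[R]_d) (E : 'M[R]_(3, d))
    (D : set 'rV[R]_2) (z N : 'rV[R]_2 -> 'rV[R]_d) : Prop :=
  row_free E /\
  minimal_surface_in (affine_space c E) (fun=> [set t | (t <= E)%MS]) D z N.

Definition minimal_in_sphere3 (R : realType) d
    (c : 'rV[R]_d) (E : 'M[R]_(4, d)) (r : R)
    (D : set 'rV[R]_2) (z N : 'rV[R]_2 -> 'rV[R]_d) : Prop :=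
  [/\ row_free E, 0 < r &
      minimal_surface_in (round_sphere c E r) (round_sphere_tangent c E)
        D z N].

Definition orthogonal_complement_basis (R : realType) k l d
    (b : 'I_k -> 'rV[R]_d) (A : 'M[R]_(l, d)) : Prop :=
  row_free (\matrix_(a < k) b a) /\
  forall v : 'rV[R]_d,
    (v <= \matrix_(a < k) b a)%MS <-> forall i, dot v (row i A) = 0.

Definition orthonormal_family (R : realType) k d (b : 'I_k -> 'rV[R]_d) : Prop :=
  forall a a', dot (b a) (b a') = (a == a')%:R.

(* The parameter is p = (u, v; w^1, ..., w^k). *)
Definition generated (R : realType) k d (z : 'rV[R]_2 -> 'rV[R]_d)
    (b : 'I_k -> 'rV[R]_2 -> 'rV[R]_d) (p : 'rV[R]_(2 + k)) : 'rV[R]_d :=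
  z (lsubmx p) + \sum_(a < k) rsubmx p 0 a *: b a (lsubmx p).

Definition immersion_domain (R : realType) k d (D : set 'rV[R]_2)
    (X : 'rV[R]_(2 + k) -> 'rV[R]_d) : set 'rV[R]_(2 + k) :=
  [set p | D (lsubmx p) /\ row_free (jacobian X p)].

Definition generates_minimal_K0 (R : realType) k d (D : set 'rV[R]_2)
    (z : 'rV[R]_2 -> 'rV[R]_d) (b : 'I_k -> 'rV[R]_2 -> 'rV[R]_d) : Prop :=
  let X := generated z b in
  let U := immersion_domain D X in
  exists N, class_K0 U X N /\ minimal_type_two U X N.

(* Main.v *)
Require Import Defs.
From mathcomp Require Import all_boot all_order all_algebra.
From mathcomp Require Import all_classical all_reals all_analysis.
From mathcomp Require Import ring lra.

(** The hypersurface is ruled by the kernel of its shape operator S, and both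
    halves of the theorem say how a surface tangent to the orthogonal
    complement Delta of that kernel sits with respect to the rulings: its
    second fundamental form in every ruling direction is a multiple of its
    metric. In other words, the second derivatives of such a surface z are
    tangential, plus a component along the normal nu of the hypersurface, plus
    G_ij H with H normal to both, where G is the metric of z.

    From minimal hypersurfaces to surfaces. Let t be in the kernel of S and let
    L be the second fundamental form of an integral surface in the direction t.
    Computing the second derivatives of nu in two ways shows that S L is
    symmetric, so that S and L commute on Delta, and that S L differs from the
    derivative S' of S along t by terms without trace
    (normal_hessian_formula). Minimality gives tr S^3 = 0 on the whole
    hypersurface (cube_trace0); differentiating, tr (S' S^2) = 0. As S^2 is a
    positive multiple of the orthogonal projection onto Delta, S' has trace
    zero on Delta, hence so has S L. An operator on a plane that commutes with
    the traceless S and satisfies this is scalar (umbilic_algebra), which is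
    the umbilicity (integral_surface_umbilic).

    The Codazzi equation then makes H parallel (mean_curvature_parallel): its
    derivative is - |H|^2 times that of z, and |H| is constant. If H = 0, the
    span of the tangent plane and nu is constant and the surface lies in an
    affine 3-space; otherwise z + H / |H|^2 is a constant centre, the span of
    the tangent plane, nu and H is constant, and the surface lies in a 3-sphere
    of radius 1 / |H| (umbilic_surface_space_form). There nu is its unit
    normal, and its shape operator, the restriction of S to Delta, has trace
    zero.

    From surfaces to hypersurfaces. A surface in an affine 3-space or in a
    3-sphere is umbilic in all directions orthogonal to that space form, with
    factor zero, respectively given by the radius. So the differential of the
    ruled map X is, modulo the rulings, a multiple mu of that of z
    (A_decomposition), and mu is nonzero where X is an immersion. The normal N
    of the surface is constant along the rulings and normal to X; the shape
    operator of X is that of the surface divided by mu, extended by zero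
    (generated_shape_op). It has two opposite nonzero eigenvalues, since the
    shape operator of the surface is self-adjoint, traceless and nonzero.
    Finally Delta is the orthogonal complement of the rulings, and it is
    involutive because the second fundamental forms of the surface in the
    ruling directions are symmetric (generated_involutive). *)

Set Implicit Arguments.
Unset Strict Implicit.
Unset Printing Implicit Defensive.

Import Order.TTheory GRing.Theory Num.Theory.
Import numFieldNormedType.Exports.

Local Open Scope classical_set_scope.
Local Open Scope ring_scope.

(** * Regularity on open sets *)

Section locality.
Context {R : realType}.
Implicit Types (V W : normedModType R).

(** A function that vanishes near x is its own remainder term, so adding g - f
    to f does not affect differentiability. *)
Lemma near_eq_differentiable V W (f g : V -> W) x :
  {near x, f =1 g} -> differentiable f x -> differentiable g x.
Proof.
move=> fg df.
have -> : g = f + (g - f) by apply/funext => y; rewrite !fctE addrC subrK.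
apply: differentiableD => //.
have dc : continuous (\0 : V -> W) by exact: cst_continuous.
have H : (g - f) \o shift x = cst ((g - f) x) + (\0 : V -> W) +o_ 0 id.
  apply/eqaddoP => _/posnumP[e].
  have: \forall y \near (0 : V), f (y + x) = g (y + x).
    have /nbhs0P h := fg; near=> y; rewrite addrC; near: y; exact: h.
  apply: filterS => y /= efg.
  by rewrite !fctE /= efg (nbhs_singleton fg) !subrr addr0 subr0
    normr0 mulr_ge0.
apply/diff_locallyP; rewrite (diff_unique dc H); split => //.
Unshelve. all: by end_near. Qed.

Lemma open_near V (U : set V) (P : V -> Prop) x :
  open U -> U x -> (forall y, U y -> P y) -> \forall y \near x, P y.
Proof. by move=> oU Ux UP; apply: filterS UP _; exact: open_nbhs_nbhs. Qed.

(** The derivatives computed below are known on U only, so regularity has to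
    be insensitive to the values taken off the open set U. *)
Lemma Ck_eq V W k (U : set V) (f g : V -> W) :
  open U -> (forall x, U x -> f x = g x) -> Ck k U f -> Ck k U g.
Proof.
move=> oU; elim: k f g => [|k IH] f g fg /=.
  move=> cf x Ux; have nfg := open_near oU Ux fg.
  have h : f @ x --> f x by exact: cf.
  rewrite /prop_for /continuous_at -(fg x Ux).
  by apply: cvg_trans h; exact: near_eq_cvg nfg.
move=> [df cf]; split=> [x Ux|v].
  by apply: near_eq_differentiable (df x Ux); exact: open_near fg.
by apply: IH (cf v) => x Ux; exact/near_eq_derive/(open_near oU Ux fg).
Qed.

Lemma Ck_pred V W k (U : set V) (f : V -> W) : Ck k.+1 U f -> Ck k U f.
Proof.
elim: k f => [|k IH] f [df cf]; last by split => // v; exact/IH/cf.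
by move=> x Ux; exact/differentiable_continuous/df.
Qed.

Lemma Ck_subset V W k (U U' : set V) (f : V -> W) :
  U' `<=` U -> Ck k U f -> Ck k U' f.
Proof.
move=> UU; elim: k f => [|k IH] f; first by move=> h x /UU; exact: h.
by move=> [df cf]; split=> [x /UU|v]; [exact: df|exact/IH/cf].
Qed.

Lemma Ck_cst V W k (U : set V) (c : W) : Ck k U (cst c).
Proof.
elim: k c => [|k IH] c; first by move=> x _; exact: cst_continuous.
split=> // v; rewrite (_ : 'D_v (cst c) = cst 0); first exact: IH.
by apply/funext => x; exact: derive_cst.
Qed.

Lemma Ck_add V W k (U : set V) (f g : V -> W) :
  open U -> Ck k U f -> Ck k U g -> Ck k U (fun x => f x + g x).
Proof.
move=> oU; elim: k f g => [|k IH] f g.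
  by move=> cf cg x Ux; apply: continuousD; [exact: cf|exact: cg].
move=> [df cf] [dg cg]; split=> [x Ux|v].
  by apply: differentiableD; [exact: df|exact: dg].
apply: (Ck_eq oU _ (IH _ _ (cf v) (cg v))) => x Ux.
rewrite -[RHS]/('D_v (f + g) x) deriveD//; apply: diff_derivable.
  exact: df.
exact: dg.
Qed.

Lemma Ck_mul V k (U : set V) (f g : V -> R) :
  open U -> Ck k U f -> Ck k U g -> Ck k U (fun x => f x * g x).
Proof.
move=> oU; elim: k f g => [|k IH] f g.
  by move=> cf cg x Ux; apply: continuousM; [exact: cf|exact: cg].
move=> [df cf] [dg cg]; split=> [x Ux|v].
  by apply: differentiableM; [exact: df|exact: dg].
have cf' : Ck k U f by apply: Ck_pred; split.
have cg' : Ck k U g by apply: Ck_pred; split.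
apply: (Ck_eq oU _ (Ck_add oU (IH _ _ cf' (cg v)) (IH _ _ cg' (cf v)))) => x Ux.
rewrite -[RHS]/('D_v (f * g) x) deriveM//; apply: diff_derivable.
  exact: df.
exact: dg.
Qed.

Lemma Ck_inv V k (U : set V) (f : V -> R) :
  open U -> (forall x, U x -> f x != 0) -> Ck k U f ->
  Ck k U (fun x => (f x)^-1).
Proof.
move=> oU f0; elim: k => [|k IH].
  by move=> cf x Ux; apply: continuousV; [exact: f0|exact: cf].
move=> [df cf]; split=> [x Ux|v].
  by apply: differentiableV; [exact: df|exact: f0].
have cf' : Ck k U (fun x => (f x)^-1) by apply: IH; apply: Ck_pred; split.
have c1 : Ck k U (cst (-1) : V -> R) by exact: Ck_cst.
have cF := Ck_mul oU c1 (Ck_mul oU (Ck_mul oU cf' cf') (cf v)).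
apply: (Ck_eq oU _ cF) => x Ux.
rewrite deriveV;
  [|exact: f0|by apply: diff_derivable; exact: df].
by rewrite -exprVn expr2 mulN1r -scaleNr.
Qed.

Lemma Ck_sum V W k (U : set V) I (r : seq I) (P : pred I) (F : I -> V -> W) :
  open U -> (forall i, P i -> Ck k U (F i)) ->
  Ck k U (fun x => \sum_(i <- r | P i) F i x).
Proof.
move=> oU cF; elim: r => [|i r IH].
  by apply: (Ck_eq oU _ (Ck_cst k U 0)) => x _; rewrite big_nil.
case Pi: (P i).
  apply: (Ck_eq oU _ (Ck_add oU (cF _ Pi) IH)) => x _.
  by rewrite big_cons Pi.
by apply: (Ck_eq oU _ IH) => x _; rewrite big_cons Pi.
Qed.

Lemma Ck_prod V k (U : set V) I (r : seq I) (P : pred I) (F : I -> V -> R) :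
  open U -> (forall i, P i -> Ck k U (F i)) ->
  Ck k U (fun x => \prod_(i <- r | P i) F i x).
Proof.
move=> oU cF; elim: r => [|i r IH].
  by apply: (Ck_eq oU _ (Ck_cst k U (1 : R))) => x _; rewrite big_nil.
case Pi: (P i).
  apply: (Ck_eq oU _ (Ck_mul oU (cF _ Pi) IH)) => x _.
  by rewrite big_cons Pi.
by apply: (Ck_eq oU _ IH) => x _; rewrite big_cons Pi.
Qed.

End locality.

Section matrix_valued.
Context {R : realType}.
Implicit Types (V : normedModType R).

Lemma differentiable_mxP V m n (F : V -> 'M[R]_(m, n)) x :
  differentiable F x <-> forall i j, differentiable (fun y => F y i j) x.
Proof.
split=> [dF i j|dF].
  exact: (differentiable_comp dF (differentiable_coord _ i j)).
have -> : F = \sum_(i < m) \sum_(j < n) (fun y => F y i j *: delta_mx i j).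
  apply/funext => y; rewrite [LHS]matrix_sum_delta fct_sumE.
  by apply: eq_bigr => i _; rewrite fct_sumE.
do 2!apply: differentiable_sum => ?.
exact/differentiableZl/dF.
Qed.

Lemma deriveE_mx V m n (F : V -> 'M[R]_(m, n)) x v i j :
  differentiable F x -> ('D_v F x) i j = 'D_v (fun y => F y i j) x.
Proof. by move=> dF; rewrite derive_mx ?mxE//; exact: diff_derivable. Qed.

(** Reduces matrix-valued maps to scalar ones, for which products and inverses
    are available. *)
Lemma Ck_mxP V k (U : set V) m n (F : V -> 'M[R]_(m, n)) : open U ->
  Ck k U F <-> forall i j, Ck k U (fun x => F x i j).
Proof.
move=> oU; elim: k F => [|k IH] F.
  split=> [cF i j x Ux|cF x Ux].
    exact: (continuous_comp (cF x Ux) (@coord_continuous _ _ _ i j _)).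
  apply/cvgrPdist_le => /= e e0; near=> y.
  rewrite /Num.Def.normr/= mx_normrE (bigmax_le _ (ltW e0))//= => i _.
  rewrite !mxE/=.
  move: i; near: y; apply: filter_forall => /= i.
  by have /cvgrPdist_le := cF i.1 i.2 x Ux; exact.
split=> [[dF cF] i j|cF].
  split=> [x Ux|v]; first by have /differentiable_mxP := dF x Ux.
  apply: (Ck_eq oU _ ((IH _).1 (cF v) i j)) => x Ux.
  by rewrite deriveE_mx//; exact: dF.
have dF x : U x -> differentiable F x.
  by move=> Ux; apply/differentiable_mxP => i j; exact: (cF i j).1.
split=> // v; apply/IH => i j.
apply: (Ck_eq oU _ ((cF i j).2 v)) => x Ux.
by rewrite deriveE_mx//; exact: dF.
Unshelve. all: by end_near. Qed.

End matrix_valued.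

Section chain_rule.
Context {R : realType}.
Implicit Types (V W : normedModType R).

Lemma derive_comp V W W' (g : W -> W') (f : V -> W) x v :
  differentiable f x -> differentiable g (f x) ->
  'D_v (g \o f) x = 'D_('D_v f x) g (f x).
Proof.
move=> df dg; rewrite !deriveE//; last exact: differentiable_comp.
by rewrite diff_comp.
Qed.

Lemma derive_dirE n W (g : 'rV[R]_n -> W) x v : differentiable g x ->
  'D_v g x = \sum_i v 0 i *: 'D_('e_i) g x.
Proof.
move=> dg; rewrite deriveE// {1}(row_sum_delta v) linear_sum.
by apply: eq_bigr => i _; rewrite linearZ deriveE.
Qed.

(** The derivatives of g o f are sums of products of derivatives of f with
    first derivatives of g taken at f; hence an induction on k in which g
    varies. *)
Lemma Ck_comp V n k (U : set V) (U' : set 'rV[R]_n) (g : 'rV[R]_n -> R)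
    (f : V -> 'rV[R]_n) : open U -> (forall x, U x -> U' (f x)) ->
  Ck k U f -> Ck k U' g -> Ck k U (g \o f).
Proof.
move=> oU UU'; elim: k g => [|k IH] g.
  move=> cf cg x Ux; apply: continuous_comp; first exact: cf.
  exact/cg/UU'.
move=> cf [dg cg]; have [df cf'] := cf; have cfk := Ck_pred cf.
split=> [x Ux|v].
  by apply: differentiable_comp; [exact: df|exact/dg/UU'].
have cF : Ck k U (fun x => \sum_i ('D_v f x) 0 i * ('D_('e_i) g \o f) x).
  apply: Ck_sum => // i _; apply: Ck_mul => //.
    exact: (Ck_mxP k _ oU).1 (cf' v) 0 i.
  exact/IH/cg.
apply: (Ck_eq oU _ cF) => x Ux.
rewrite [RHS]derive_comp; [|exact: df|exact/dg/UU'].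
by rewrite derive_dirE//; exact/dg/UU'.
Qed.

End chain_rule.

Section smooth.
Context {R : realType}.
Implicit Types (V W : normedModType R).

Lemma smooth_differentiable V W (U : set V) (f : V -> W) x :
  smooth_on U f -> U x -> differentiable f x.
Proof. by move=> /(_ 1%N)[df _]; exact: df. Qed.

Lemma smooth_derive V W (U : set V) (f : V -> W) v :
  smooth_on U f -> smooth_on U ('D_v f).
Proof. by move=> sf k; have [_] := sf k.+1; exact. Qed.

Lemma smooth_eq V W (U : set V) (f g : V -> W) :
  open U -> (forall x, U x -> f x = g x) -> smooth_on U f -> smooth_on U g.
Proof. by move=> oU fg sf k; exact: Ck_eq (sf k). Qed.

Lemma smooth_subset V W (U U' : set V) (f : V -> W) :
  U' `<=` U -> smooth_on U f -> smooth_on U' f.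
Proof. by move=> UU sf k; exact: Ck_subset (sf k). Qed.

Lemma smooth_cst V W (U : set V) (c : W) : smooth_on U (cst c).
Proof. by move=> k; exact: Ck_cst. Qed.

Lemma smooth_mxP V (U : set V) m n (F : V -> 'M[R]_(m, n)) : open U ->
  smooth_on U F <-> forall i j, smooth_on U (fun x => F x i j).
Proof.
move=> oU; split=> [sF i j k|sF k].
  exact: (Ck_mxP k F oU).1 (sF k) i j.
by apply/(Ck_mxP k F oU) => i j; exact: sF.
Qed.

Lemma smooth_add V W (U : set V) (f g : V -> W) : open U ->
  smooth_on U f -> smooth_on U g -> smooth_on U (fun x => f x + g x).
Proof. by move=> oU sf sg k; exact: Ck_add. Qed.

Lemma smooth_mul V (U : set V) (f g : V -> R) : open U ->
  smooth_on U f -> smooth_on U g -> smooth_on U (fun x => f x * g x).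
Proof. by move=> oU sf sg k; exact: Ck_mul. Qed.

Lemma smooth_inv V (U : set V) (f : V -> R) : open U ->
  (forall x, U x -> f x != 0) ->
  smooth_on U f -> smooth_on U (fun x => (f x)^-1).
Proof. by move=> oU f0 sf k; exact: Ck_inv. Qed.

Lemma smooth_sum V W (U : set V) I (r : seq I) (P : pred I) (F : I -> V -> W) :
  open U -> (forall i, smooth_on U (F i)) ->
  smooth_on U (fun x => \sum_(i <- r | P i) F i x).
Proof. by move=> oU sF k; apply: Ck_sum => // i _; exact: sF. Qed.

Lemma smooth_prod V (U : set V) I (r : seq I) (P : pred I) (F : I -> V -> R) :
  open U -> (forall i, smooth_on U (F i)) ->
  smooth_on U (fun x => \prod_(i <- r | P i) F i x).
Proof. by move=> oU sF k; apply: Ck_prod => // i _; exact: sF. Qed.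

Lemma smooth_scale V m n (U : set V) (f : V -> R) (F : V -> 'M[R]_(m, n)) :
  open U -> smooth_on U f -> smooth_on U F -> smooth_on U (fun x => f x *: F x).
Proof.
move=> oU sf /(smooth_mxP _ oU) sF; apply/smooth_mxP => // i j.
apply: (smooth_eq oU _ (smooth_mul oU sf (sF i j))) => x _.
by rewrite mxE.
Qed.

Lemma smooth_opp V m n (U : set V) (F : V -> 'M[R]_(m, n)) :
  open U -> smooth_on U F -> smooth_on U (fun x => - F x).
Proof.
move=> oU sF; have s1 : smooth_on U (cst (-1) : V -> R) by exact: smooth_cst.
apply: (smooth_eq oU _ (smooth_scale oU s1 sF)) => x _ /=.
by rewrite scaleN1r.
Qed.

Lemma smooth_trmx V m n (U : set V) (F : V -> 'M[R]_(m, n)) :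
  open U -> smooth_on U F -> smooth_on U (fun x => (F x)^T).
Proof.
move=> oU /(smooth_mxP _ oU) sF; apply/smooth_mxP => // i j.
by apply: (smooth_eq oU _ (sF j i)) => x _; rewrite mxE.
Qed.

Lemma smooth_mulmx V m n p (U : set V) (F : V -> 'M[R]_(m, n))
    (G : V -> 'M[R]_(n, p)) :
  open U -> smooth_on U F -> smooth_on U G -> smooth_on U (fun x => F x *m G x).
Proof.
move=> oU /(smooth_mxP _ oU) sF /(smooth_mxP _ oU) sG.
apply/smooth_mxP => // i j.
have sH : smooth_on U (fun x => \sum_k F x i k * G x k j).
  by apply: smooth_sum => // k; exact: smooth_mul.
by apply: (smooth_eq oU _ sH) => x _; rewrite mxE.
Qed.

Lemma smooth_det V n (U : set V) (F : V -> 'M[R]_n) :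
  open U -> smooth_on U F -> smooth_on U (fun x => \det (F x)).
Proof.
move=> oU /(smooth_mxP _ oU) sF.
apply: (@smooth_sum V R U) => // s; apply: smooth_mul => //.
  exact: smooth_cst.
by apply: smooth_prod => // i; exact: sF.
Qed.

(** By Cramer's rule, the entries are polynomials in those of F divided by the
    determinant. *)
Lemma smooth_invmx V n (U : set V) (F : V -> 'M[R]_n) :
  open U -> (forall x, U x -> F x \in unitmx) ->
  smooth_on U F -> smooth_on U (fun x => invmx (F x)).
Proof.
move=> oU F0 sF; apply/smooth_mxP => // i j.
have d0 x : U x -> \det (F x) != 0.
  by move=> /F0; rewrite unitmxE unitfE.
have si := smooth_inv oU d0 (smooth_det oU sF).
have sc : smooth_on U (fun x => (\adj (F x)) i j).
  have H : smooth_on U (fun x => (-1) ^+ (j + i) * \det (row' j (col' i (F x)))).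
    apply: smooth_mul => //; first exact: smooth_cst.
    apply: smooth_det => //; apply/smooth_mxP => // a b.
    apply: (smooth_eq oU _ ((smooth_mxP F oU).1 sF (lift j a) (lift i b))) => x _.
    by rewrite !mxE.
  by apply: (smooth_eq oU _ H) => x _; rewrite mxE.
apply: (smooth_eq oU _ (smooth_mul oU si sc)) => x Ux.
by rewrite /invmx F0// [RHS]mxE.
Qed.

Lemma smooth_comp V n p q (U : set V) (U' : set 'rV[R]_n)
    (g : 'rV[R]_n -> 'M[R]_(p, q)) (f : V -> 'rV[R]_n) :
  open U -> open U' -> (forall x, U x -> U' (f x)) ->
  smooth_on U f -> smooth_on U' g -> smooth_on U (g \o f).
Proof.
move=> oU oU' UU' sf /(smooth_mxP _ oU') sg; apply/smooth_mxP => // i j k.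
exact: (@Ck_comp R V n k U U' (fun y => g y i j) f oU UU' (sf k) (sg i j k)).
Qed.

Lemma jacobianE m d (X : 'rV[R]_m -> 'rV[R]_d) x i j :
  differentiable X x -> jacobian X x i j = ('D_('e_i) X x) 0 j.
Proof. by move=> dX; rewrite deriveEjacobian// -rowE [RHS]mxE. Qed.

Lemma row_jacobian m d (X : 'rV[R]_m -> 'rV[R]_d) x i :
  differentiable X x -> row i (jacobian X x) = 'D_('e_i) X x.
Proof. by move=> dX; rewrite rowE deriveEjacobian. Qed.

Lemma smooth_jacobian m d (U : set 'rV[R]_m) (X : 'rV[R]_m -> 'rV[R]_d) :
  open U -> smooth_on U X -> smooth_on U (jacobian X).
Proof.
move=> oU sX; apply/smooth_mxP => // i j.
apply: (smooth_eq oU _ ((smooth_mxP _ oU).1 (smooth_derive 'e_i sX) 0 j)).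
by move=> x Ux; rewrite jacobianE//; exact: smooth_differentiable Ux.
Qed.

Lemma jacobian_comp m n d (g : 'rV[R]_n -> 'rV[R]_d) (f : 'rV[R]_m -> 'rV[R]_n)
    x : differentiable f x -> differentiable g (f x) ->
  jacobian (g \o f) x = jacobian f x *m jacobian g (f x).
Proof.
move=> df dg; apply/row_matrixP => i.
rewrite row_jacobian; last exact: differentiable_comp.
by rewrite derive_comp// deriveEjacobian// -row_jacobian// row_mul.
Qed.

End smooth.

Section derivative_of_matrices.
Context {R : realType}.
Implicit Types (V : normedModType R).

Lemma differentiable_mulmx V m n p (F : V -> 'M[R]_(m, n))
    (G : V -> 'M[R]_(n, p)) x : differentiable F x -> differentiable G x ->
  differentiable (fun y => F y *m G y) x.
Proof.
move=> /differentiable_mxP dF /differentiable_mxP dG.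
apply/differentiable_mxP => i j.
rewrite (_ : (fun _ => _) = \sum_k (fun y => F y i k) * (fun y => G y k j)).
  by apply: differentiable_sum => k; exact: differentiableM.
by apply/funext => y; rewrite mxE fct_sumE.
Qed.

Lemma derive_mulmx V m n p (F : V -> 'M[R]_(m, n)) (G : V -> 'M[R]_(n, p)) x v :
  differentiable F x -> differentiable G x ->
  'D_v (fun y => F y *m G y) x = 'D_v F x *m G x + F x *m 'D_v G x.
Proof.
move=> dF dG; have dFG := differentiable_mulmx dF dG.
apply/matrixP => i j; rewrite deriveE_mx//.
have dFij a b : derivable (fun y => F y a b) x v.
  by apply: diff_derivable; exact: (differentiable_mxP F x).1.
have dGij a b : derivable (fun y => G y a b) x v.
  by apply: diff_derivable; exact: (differentiable_mxP G x).1.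
rewrite (_ : (fun _ => _) = \sum_k (fun y => F y i k) * (fun y => G y k j)).
  rewrite derive_sum; last by move=> k; exact: derivableM.
  rewrite !mxE -big_split; apply: eq_bigr => k _ /=.
  by rewrite deriveM// !deriveE_mx// addrC; congr (_ + _); exact: mulrC.
by apply/funext => y; rewrite mxE fct_sumE.
Qed.

Lemma derive_trmx V m n (F : V -> 'M[R]_(m, n)) x v :
  differentiable F x -> 'D_v (fun y => (F y)^T) x = ('D_v F x)^T.
Proof.
move=> dF; have dFt : differentiable (fun y => (F y)^T) x.
  apply/differentiable_mxP => i j.
  rewrite (_ : (fun _ => _) = fun y => F y j i).
    exact: (differentiable_mxP F x).1.
  by apply/funext => y; rewrite mxE.
apply/matrixP => i j; rewrite deriveE_mx// mxE deriveE_mx//.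
by congr ('D_v _ x); apply/funext => y; rewrite mxE.
Qed.

Lemma differentiable_trmx V m n (F : V -> 'M[R]_(m, n)) x :
  differentiable F x -> differentiable (fun y => (F y)^T) x.
Proof.
move=> /differentiable_mxP dF; apply/differentiable_mxP => i j.
rewrite (_ : (fun _ => _) = fun y => F y j i)//.
by apply/funext => y; rewrite mxE.
Qed.

End derivative_of_matrices.

(** * Second derivatives and constancy *)

Section mean_value.
Context {R : realType}.
Implicit Types (V : normedModType R).

Lemma is_derive_line V (f : V -> R) x v (t : R) :
  differentiable f (x + t *: v) ->
  is_derive t 1 (fun s => f (x + s *: v)) ('D_v f (x + t *: v)).
Proof.
move=> df.
have dl : differentiable (fun s : R => x + s *: v) t.
  by apply: differentiableD => //; exact: differentiableZl.
have Dl : 'D_1 (fun s : R => x + s *: v) t = v.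
  have -> : (fun s : R => x + s *: v) = cst x + ( *:%R^~ v : R -> V) by [].
  rewrite deriveD//.
  - by rewrite derive_cst add0r deriveE// diff_val scale1r.
  - exact/diff_derivable/ex_diff.
apply: DeriveDef.
  by apply: diff_derivable; exact: (differentiable_comp dl df).
by have := @derive_comp R _ _ _ f (fun s : R => x + s *: v) t 1 dl df;
  rewrite Dl.
Qed.

Lemma mean_value_line V (f : V -> R) x v (h : R) : 0 < h ->
  (forall t, 0 <= t <= h -> differentiable f (x + t *: v)) ->
  exists2 t, 0 < t < h & f (x + h *: v) - f x = h * 'D_v f (x + t *: v).
Proof.
move=> h0 df.
have dl t : 0 <= t <= h -> is_derive t 1 (fun s => f (x + s *: v))
    ('D_v f (x + t *: v)) by move=> /df; exact: is_derive_line.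
have [| |t] := @MVT _ (fun s => f (x + s *: v))
    (fun t => 'D_v f (x + t *: v)) 0 h h0.
- by move=> t; rewrite in_itv /= => /andP[t0 th]; apply: dl; rewrite !ltW.
- apply: derivable_within_continuous => t; rewrite in_itv /= => /dl; exact.
by rewrite in_itv /= scale0r addr0 subr0 mulrC => th e; exists t.
Qed.

(** The mean value theorem is applied along v to the difference f (y + h w) -
    f y, and then along w. The left-hand side is symmetric in v and w. *)
Lemma second_difference V (f : V -> R) (U : set V) x v w (h : R) : 0 < h ->
  Ck 2 U f ->
  (forall s t : R, 0 <= s <= h -> 0 <= t <= h -> U (x + s *: v + t *: w)) ->
  exists s t : R, [/\ 0 < s < h, 0 < t < h &
    f (x + h *: v + h *: w) - f (x + h *: v) - f (x + h *: w) + f x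
      = h ^+ 2 * 'D_w ('D_v f) (x + s *: v + t *: w)].
Proof.
move=> h0 [df cf] inU.
have h00 : 0 <= h <= h by rewrite ltW /=.
have z00 : (0 : R) <= 0 <= h by rewrite lexx ltW.
pose g := (fun y => f (y + h *: w)) - f.
have shift_diff y : differentiable f (y + h *: w) ->
    differentiable (fun y => f (y + h *: w)) y.
  move=> d; apply: (@differentiable_comp _ _ _ _ (fun y => y + h *: w)) => //.
have dg t : 0 <= t <= h -> differentiable g (x + t *: v).
  move=> th; apply: differentiableB; first by apply/shift_diff/df/inU.
  by apply: df; rewrite -[_ + _]addr0 -(scale0r w); exact: inU.
have [s sh es] := mean_value_line h0 dg.
have s01 : 0 <= s <= h by case/andP: sh => s0 s1; rewrite !ltW.
have dD t : 0 <= t <= h -> differentiable ('D_v f) (x + s *: v + t *: w).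
  by move=> th; have [d _] := cf v; apply/d/inU.
have [t th et] := mean_value_line h0 dD.
have Dg : 'D_v g (x + s *: v) =
    'D_v f (x + s *: v + h *: w) - 'D_v f (x + s *: v).
  have ds : differentiable f (x + s *: v).
    by rewrite -[_ + _]addr0 -(scale0r w); apply/df/inU.
  have dsh : differentiable f (x + s *: v + h *: w) by apply/df/inU.
  rewrite deriveB; [|exact/diff_derivable/shift_diff|exact: diff_derivable].
  congr (_ - _).
  have -> : (fun y => f (y + h *: w)) = f \o (+%R^~ (h *: w)) by [].
  rewrite derive_comp//=.
    have -> : +%R^~ (h *: w) = id + cst (h *: w) :> (V -> V) by [].
    by rewrite deriveD// derive_id derive_cst addr0.
exists s, t; split => //.
rewrite expr2 -mulrA -et -Dg -es /g !fctE.
by ring.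
Qed.

(** Computing the second difference in both orders shows that the two mixed
    derivatives take a common value at points arbitrarily close to x; they are
    continuous. *)
Lemma derive_derive_sym V (f : V -> R) (U : set V) x v w :
  open U -> Ck 2 U f -> U x -> 'D_v ('D_w f) x = 'D_w ('D_v f) x.
Proof.
move=> oU cf Ux; apply/eqP; rewrite -subr_eq0 -normr_le0.
apply/ler_addgt0Pl => e e0; rewrite addr0.
have [df cf'] := cf.
pose P1 := [set y | `|'D_v ('D_w f) x - 'D_v ('D_w f) y| <= e / 2].
pose P2 := [set y | `|'D_w ('D_v f) x - 'D_w ('D_v f) y| <= e / 2].
have near_ok : nbhs x (U `&` (P1 `&` P2)).
  have e2 : 0 < e / 2 by rewrite divr_gt0.
  apply: filterI; first exact: open_nbhs_nbhs.
  apply: filterI.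
    have /cvgrPdist_le c1 : {for x, continuous ('D_v ('D_w f))}.
      by have [_ /(_ v)] := cf' w; exact.
    exact: c1 _ e2.
  have /cvgrPdist_le c2 : {for x, continuous ('D_w ('D_v f))}.
    by have [_ /(_ w)] := cf' v; exact.
  exact: c2 _ e2.
have [r /= r0 ball_ok] := (nbhs_ballP _ _).1 near_ok.
pose c := `|v| + `|w| + 1.
have c0 : 0 < c by rewrite ltr_wpDl// addr_ge0.
pose h := r / (2 * c).
have h0 : 0 < h by rewrite divr_gt0// mulr_gt0.
have in_ball s t : 0 <= s <= h -> 0 <= t <= h -> ball x r (x + s *: v + t *: w).
  move=> /andP[s0 sh] /andP[t0 th].
  rewrite -ball_normE /= -addrA opprD addNKr normrN.
  apply: (le_lt_trans (ler_normD _ _)); rewrite !normrZ !ger0_norm//.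
  apply: (@le_lt_trans _ _ (h * c)).
    rewrite mulrDr mulr1 mulrDr -[leLHS]addr0 lerD ?(ltW h0)//.
    by rewrite lerD// ler_wpM2r.
  by rewrite /h invfM mulrA divfK ?gt_eqF// ltr_pdivrMr// ltr_pMr// ltr1n.
have in_ball' s t : 0 <= s <= h -> 0 <= t <= h -> ball x r (x + s *: w + t *: v).
  by move=> sh th; rewrite addrAC; exact: in_ball.
have [s [t [sh th e1]]] := second_difference h0 cf
  (fun s t sh th => let: conj u _ := ball_ok _ (in_ball s t sh th) in u).
have [s' [t' [sh' th' e2]]] := second_difference h0 cf
  (fun s t sh th => let: conj u _ := ball_ok _ (in_ball' s t sh th) in u).
have itvW (a : R) : 0 < a < h -> 0 <= a <= h by case/andP => ? ?; rewrite !ltW.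
have [_ [_ b1]] := ball_ok _ (in_ball _ _ (itvW _ sh) (itvW _ th)).
have [_ [b2 _]] := ball_ok _ (in_ball' _ _ (itvW _ sh') (itvW _ th')).
have E : 'D_w ('D_v f) (x + s *: v + t *: w) =
    'D_v ('D_w f) (x + s' *: w + t' *: v).
  have h2 : h ^+ 2 != 0 by rewrite sqrf_eq0 gt_eqF.
  apply: (mulfI h2 (etrans (esym e1) (etrans _ e2))).
  by rewrite (addrAC x); ring.
rewrite /P1 /= -E in b2; rewrite /P2 /= in b1; rewrite (splitr e).
rewrite -(subrKA ('D_w ('D_v f) (x + s *: v + t *: w))).
apply: (le_trans (ler_normD _ _)); apply: lerD b2 _.
by rewrite distrC; exact: b1.
Qed.

Lemma derive_derive_sym_mx V m n (F : V -> 'M[R]_(m, n)) (U : set V) x v w :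
  open U -> smooth_on U F -> U x -> 'D_v ('D_w F) x = 'D_w ('D_v F) x.
Proof.
move=> oU sF Ux; apply/matrixP => i j.
have E a b y : U y -> ('D_a ('D_b F) y) i j =
    'D_a ('D_b (fun z => F z i j)) y.
  move=> Uy; rewrite deriveE_mx; last first.
    exact: smooth_differentiable (smooth_derive b sF) Uy.
  apply: near_eq_derive; apply: (open_near oU Uy) => z Uz.
  by rewrite deriveE_mx//; exact: smooth_differentiable sF Uz.
have c2 := (smooth_mxP F oU).1 sF i j 2%N.
have S := @derive_derive_sym _ _ _ _ v w oU c2 Ux.
exact: etrans (E v w x Ux) (etrans S (esym (E w v x Ux))).
Qed.

(** By the mean value theorem f is constant on balls, so its level sets are
    open and closed in D. *)
Lemma derive0_connected V (f : V -> R) (D : set V) : open D -> connected D ->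
  (forall x, D x -> differentiable f x) ->
  (forall x v, D x -> 'D_v f x = 0) -> forall x y, D x -> D y -> f x = f y.
Proof.
move=> oD cD df Df x0 y0 Dx0 Dy0.
have loc x : D x -> \forall y \near x, D y /\ f y = f x.
  move=> Dx; have [r /= r0 br] := (nbhs_ballP _ _).1 (open_nbhs_nbhs (conj oD Dx)).
  apply/nbhs_ballP; exists r => //= y yr; split; first exact: br.
  have inD t : 0 <= t <= 1 -> D (x + t *: (y - x)).
    move=> /andP[t0 t1]; apply: br; move: yr; rewrite -!ball_normE /=.
    rewrite opprD addNKr normrN normrZ ger0_norm// distrC; apply: le_lt_trans.
    by rewrite ler_piMl.
  have [t th] := mean_value_line ltr01 (fun t th => df _ (inD t th)).
  rewrite Df ?mulr0; last by apply: inD; case/andP: th => ? ?; rewrite !ltW.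
  by rewrite scale1r [x + _]addrC subrK => /eqP; rewrite subr_eq0 => /eqP.
have op (P : set R) : open [set y | D y /\ P (f y)].
  rewrite openE => y [Dy Py]; apply: filterS (loc y Dy) => z [Dz fz].
  by split=> //; rewrite fz.
suff : [set y | D y /\ f y = f x0] = D by move=> /seteqP[_ /(_ y0 Dy0)[_ ->]].
apply: cD.
- by exists x0.
- exists [set y | D y /\ f y = f x0]; first exact: op [set f x0].
  by apply/seteqP; split=> [y []//|y [_ []]].
- exists (~` [set y | D y /\ f y <> f x0]).
    by apply: open_closedC; exact: op [set a | a <> f x0].
  apply/seteqP; split=> [y [Dy fy]|y [Dy]] /=; first by split=> // -[].
  by move=> /not_andP[//|/contrapT fy].
Qed.

Lemma derive0_connected_mx V m n (F : V -> 'M[R]_(m, n)) (D : set V) :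
  open D -> connected D -> (forall x, D x -> differentiable F x) ->
  (forall x v, D x -> 'D_v F x = 0) -> forall x y, D x -> D y -> F x = F y.
Proof.
move=> oD cD dF DF x y Dx Dy; apply/matrixP => i j.
apply: (@derive0_connected _ (fun z => F z i j) D) => // z.
  by move=> Dz; exact: (differentiable_mxP F z).1 (dF z Dz) i j.
by move=> v Dz; rewrite -deriveE_mx ?DF ?mxE//; exact: dF.
Qed.

End mean_value.

(** * Gram matrices and the equations of a hypersurface *)

Section gram.
Context {R : realType}.

Lemma dotE d (u v : 'rV[R]_d) : dot u v = (u *m v^T) 0 0.
Proof. by rewrite mxE; apply: eq_bigr => i _; rewrite mxE. Qed.

Lemma mulmx_row_tr m n p (P : 'M[R]_(m, n)) (Q : 'M[R]_(p, n)) i j :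
  (row i P *m (row j Q)^T) 0 0 = (P *m Q^T) i j.
Proof. by rewrite !mxE; apply: eq_bigr => k _; rewrite !mxE. Qed.

Lemma mulmx_tr_dot m n p (P : 'M[R]_(m, n)) (Q : 'M[R]_(p, n)) i j :
  (P *m Q^T) i j = dot (row i P) (row j Q).
Proof. by rewrite dotE mulmx_row_tr. Qed.

Lemma dot_eq0 d (u v : 'rV[R]_d) : dot u v = 0 <-> u *m v^T = 0.
Proof.
split=> [uv|uv]; last by rewrite dotE uv mxE.
by apply/matrixP => i j; rewrite !ord1 -dotE uv mxE.
Qed.

Lemma mulmx_tr_eq0 m d (A : 'M[R]_(m, d)) : (A *m A^T == 0) = (A == 0).
Proof.
apply/eqP/eqP => [A0|->]; last by rewrite mul0mx.
apply/matrixP => i j; rewrite mxE; apply/eqP; rewrite -sqrf_eq0.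
have : (A *m A^T) i i = 0 by rewrite A0 mxE.
rewrite mxE => /eqP; rewrite psumr_eq0; last first.
  by move=> k _; rewrite mxE -expr2 sqr_ge0.
by move=> /allP/(_ j (mem_index_enum _)); rewrite mxE -expr2.
Qed.

Lemma gram_unit m d (A : 'M[R]_(m, d)) : (A *m A^T \in unitmx) = row_free A.
Proof.
apply/idP/idP => [Au|Af].
  rewrite -row_free_unit in Au; apply: contraTT Au.
  rewrite -!kermx_eq0; apply: contraNN => /eqP k0.
  rewrite -submx0 -k0; apply/sub_kermxP.
  by rewrite mulmxA mulmx_ker mul0mx.
rewrite -row_free_unit -kermx_eq0.
have : kermx (A *m A^T) *m A == 0.
  by rewrite -mulmx_tr_eq0 trmx_mul !mulmxA -(mulmxA _ A) mulmx_ker mul0mx.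
by rewrite -(inj_eq (row_free_inj Af)) mul0mx.
Qed.

Lemma unit_row_free d (u : 'rV[R]_d) : dot u u = 1 -> row_free u.
Proof.
move=> uu; rewrite -gram_unit (_ : _ *m _ = 1%:M) ?unitmx1//.
by apply/matrixP => i j; rewrite !ord1 -dotE uu mxE.
Qed.

Lemma trmx_gram m d (A : 'M[R]_(m, d)) : (A *m A^T)^T = A *m A^T.
Proof. by rewrite trmx_mul trmxK. Qed.

Lemma row_free_orthogonal k l d (F : 'M[R]_(k, d)) (B : 'M[R]_(l, d)) :
  row_free F -> row_free B -> F *m B^T = 0 -> row_free (col_mx F B).
Proof.
move=> Ff Bf FB; rewrite -gram_unit tr_col_mx mul_col_row FB.
have -> : B *m F^T = 0 by rewrite -[LHS]trmxK trmx_mul trmxK FB trmx0.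
by rewrite unitmxE det_ublock unitrM -!unitmxE !gram_unit Ff.
Qed.

(** By the dimension count F and B together span the whole space, and v F^T =
    0 kills the F-component of v. *)
Lemma sub_orthogonal k l d (F : 'M[R]_(k, d)) (B : 'M[R]_(l, d)) p
    (v : 'M[R]_(p, d)) : (k + l = d)%N ->
  row_free F -> row_free B -> F *m B^T = 0 -> v *m F^T = 0 -> (v <= B)%MS.
Proof.
move=> kld Ff Bf FB vF; have := row_free_orthogonal Ff Bf FB.
rewrite /row_free => /eqP rk.
have : row_full (col_mx F B) by rewrite /row_full rk kld.
move=> /(submx_full v)/submxP[C vE]; rewrite -[C]hsubmxK mul_row_col in vE.
move: vF; rewrite vE mulmxDl -!mulmxA.
have -> : B *m F^T = 0 by rewrite -[LHS]trmxK trmx_mul trmxK FB trmx0.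
rewrite mulmx0 addr0 => /(congr1 (mulmx^~ (invmx (F *m F^T)))).
rewrite mulmxK ?gram_unit// mul0mx => ->.
by rewrite mul0mx add0r submxMl.
Qed.

End gram.

Section second_order.
Context {R : realType} {m d : nat}.
Implicit Types (U : set 'rV[R]_m) (X N : 'rV[R]_m -> 'rV[R]_d).

Lemma first_ffE X x : differentiable X x ->
  first_ff X x = jacobian X x *m (jacobian X x)^T.
Proof.
move=> dX; apply/matrixP => i j; rewrite [LHS]mxE [RHS]mxE; apply: eq_bigr => k _.
by rewrite [_^T _ _]mxE !jacobianE.
Qed.

Lemma jacobian_normal0 X (N : 'rV[R]_d) x :
  (forall v, dot (v *m jacobian X x) N = 0) -> jacobian X x *m N^T = 0.
Proof.
move=> H; apply/row_matrixP => i; rewrite row0 row_mul rowE.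
exact/dot_eq0.
Qed.

(** Differentiate the relation jacobian X *m N^T = 0. *)
Lemma second_ffE U X N x : open U -> smooth_on U X -> smooth_on U N ->
  (forall y, U y -> jacobian X y *m (N y)^T = 0) -> U x ->
  second_ff X N x = - (jacobian X x *m (jacobian N x)^T).
Proof.
move=> oU sX sN XN Ux; apply/matrixP => i j.
have dN := smooth_differentiable sN Ux.
have dX := smooth_differentiable sX Ux.
have dX' := smooth_differentiable (smooth_derive 'e_i sX) Ux.
have : 'D_('e_j) (fun y => 'D_('e_i) X y *m (N y)^T) x = 0.
  rewrite -(derive_cst (0 : 'M[R]_1) x 'e_j).
  apply: near_eq_derive; apply: (open_near oU Ux) => y Uy.
  rewrite -row_jacobian; last exact: smooth_differentiable Uy.
  by rewrite -row_mul XN// row0.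
rewrite derive_mulmx//; last exact: differentiable_trmx.
rewrite derive_trmx// => /eqP; rewrite addr_eq0 => /eqP E.
rewrite [LHS]mxE dotE E -(row_jacobian _ dX) -(row_jacobian _ dN).
move: (jacobian X x) (jacobian N x) => A B.
by rewrite !mxE; congr (- _); apply: eq_bigr => k _; rewrite !mxE.
Qed.

Lemma second_ff_sym U X N x : open U -> smooth_on U X -> U x ->
  (second_ff X N x)^T = second_ff X N x.
Proof.
move=> oU sX Ux; apply/matrixP => i j; rewrite !mxE.
have E := derive_derive_sym_mx 'e_i 'e_j oU sX Ux.
exact: (congr1 (fun u => dot u (N x)) E).
Qed.

(** Differentiate |N|^2 = 1. *)
Lemma normal_derivative0 U N x : open U -> smooth_on U N ->
  (forall y, U y -> dot (N y) (N y) = 1) -> U x ->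
  jacobian N x *m (N x)^T = 0.
Proof.
move=> oU sN NN Ux; apply/row_matrixP => i; rewrite row0 row_mul.
have dN := smooth_differentiable sN Ux.
rewrite row_jacobian//.
have : 'D_('e_i) (fun y => N y *m (N y)^T) x = 0.
  rewrite -(derive_cst (1 : 'M[R]_1) x 'e_i).
  apply: near_eq_derive; apply: (open_near oU Ux) => y Uy.
  by apply/matrixP => a b; rewrite !ord1 -dotE NN// mxE.
rewrite derive_mulmx//; last exact: differentiable_trmx.
rewrite derive_trmx// => /matrixP/(_ 0 0).
move: ('D_('e_i) N x) => a.
rewrite mxE -!dotE [dot _ a](_ : _ = dot a (N x)); last first.
  by apply: eq_bigr => k _; rewrite mulrC.
rewrite mxE => /eqP; rewrite -mulr2n mulrn_eq0 /= => /eqP.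
exact: (dot_eq0 _ _).1.
Qed.

End second_order.

(** Both sides have the same products with the rows of jacobian X, by
    definition of the shape operator, and with N, because N has constant
    length; in codimension one these vectors span the ambient space. *)
Lemma weingarten {R : realType} m (U : set 'rV[R]_m)
    (X N : 'rV[R]_m -> 'rV[R]_m.+1) x :
  regular_patch U X -> unit_normal (fun=> setT) U X N -> U x ->
  jacobian N x = - (shape_op X N x *m jacobian X x).
Proof.
move=> [oU sX Xf] [sN HN] Ux.
have XN y : U y -> jacobian X y *m (N y)^T = 0.
  by move=> /HN[_ _]; exact: jacobian_normal0.
have NN y : U y -> dot (N y) (N y) = 1 by move=> /HN[].
have NN1 : N x *m (N x)^T = 1%:M.
  by apply/matrixP => i j; rewrite !ord1 -dotE NN// mxE.
have Nf : row_free (N x) by apply: unit_row_free; exact: NN.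
have Au : jacobian X x *m (jacobian X x)^T \in unitmx.
  by rewrite gram_unit; exact: Xf.
apply/eqP; rewrite -addr_eq0; apply/eqP; set v := _ + _.
have vA : v *m (jacobian X x)^T = 0.
  rewrite mulmxDl -mulmxA /shape_op first_ffE; last first.
    exact: smooth_differentiable Ux.
  rewrite mulmxKV// -(second_ff_sym N oU sX Ux).
  by rewrite (second_ffE oU sX sN XN Ux) linearN /= trmx_mul trmxK subrr.
have vN : v *m (N x)^T = 0.
  rewrite mulmxDl (normal_derivative0 oU sN NN Ux) add0r -mulmxA XN//.
  by rewrite mulmx0.
have : (v <= N x)%MS.
  exact: sub_orthogonal (addn1 m) (Xf x Ux) Nf (XN x Ux) vA.
move=> /submxP[c ve]; move: vN; rewrite ve -mulmxA NN1 mulmx1 => ->.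
by rewrite mul0mx.
Qed.

(** * Two by two matrices, eigenvalues, and the algebra of umbilicity *)

Lemma det22E {F : comNzRingType} (A : 'M[F]_2) :
  \det A = A 0 0 * A 1 1 - A 0 1 * A 1 0.
Proof.
rewrite (expand_det_row _ 0) !big_ord_recl big_ord0 addr0 /cofactor !det_mx11.
rewrite !mxE /= !addn0 expr0 mul1r add0n expr1 mulN1r mulrN.
by congr (A _ _ * A _ _ - A _ _ * A _ _); apply: val_inj.
Qed.

Section two_by_two.
Context {F : realFieldType}.
Implicit Types (A B : 'M[F]_2).

Lemma mulmx22E A B i j : (A *m B) i j = A i 0 * B 0 j + A i 1 * B 1 j.
Proof.
rewrite mxE !big_ord_recl big_ord0 addr0.
by congr (_ + A i _ * B _ j); apply: val_inj.
Qed.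

Lemma mxtrace22E A : \tr A = A 0 0 + A 1 1.
Proof.
rewrite /mxtrace !big_ord_recl big_ord0 addr0.
by congr (_ + A _ _); apply: val_inj.
Qed.

Lemma matrix22P A B : A 0 0 = B 0 0 -> A 0 1 = B 0 1 -> A 1 0 = B 1 0 ->
  A 1 1 = B 1 1 -> A = B.
Proof.
move=> h00 h01 h10 h11; apply/matrixP => i j.
have ordE (k : 'I_2) : (k = 0) \/ (k = 1).
  by case: k => [[|[|//]] lt]; [left|right]; apply: val_inj.
by case: (ordE i) => ->; case: (ordE j) => ->.
Qed.

Lemma traceless_sqr A : \tr A = 0 -> A *m A = (- \det A)%:M.
Proof.
rewrite mxtrace22E => /eqP; rewrite addr_eq0 => /eqP trA.
by apply: matrix22P; rewrite mulmx22E !mxE det22E trA /=; ring.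
Qed.

(** A matrix that commutes with a non-scalar 2 x 2 matrix A is a combination
    of 1 and A. As A^2 = - det A is a nonzero scalar, the trace condition
    removes the multiple of A. *)
Lemma commute_traceless A B : \tr A = 0 -> \det A != 0 ->
  A *m B = B *m A -> \tr (A *m B) = 0 -> B = (B 0 0)%:M.
Proof.
move=> trA dA AB trAB.
have key (p q r x y z w : F) : p * p + q * r != 0 ->
    q * z = r * y -> p * y + q * w = x * q - y * p ->
    r * x - p * z = z * p + w * r -> p * x + q * z + (r * y - p * w) = 0 ->
    [/\ y = 0, z = 0 & w = x].
  move=> d0 e00 e01 e10 e.
  have h1 : (p * p + q * r) * (x - w) = 0.
    have -> : (p * p + q * r) * (x - w) =
      p * (p * x + q * z + (r * y - p * w)) + p * (q * z - r * y) +
      q * (r * x - p * z - (z * p + w * r)) by ring.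
    by rewrite e e00 e10; ring.
  have xw : x = w.
    by move/eqP: h1; rewrite mulf_eq0 (negbTE d0) subr_eq0 => /eqP.
  rewrite -{}xw in e01 e10 e *.
  have py : p * y = 0 by lra.
  have ry : r * y = 0 by lra.
  have qz : q * z = 0 by lra.
  have pz : p * z = 0 by lra.
  have h2 : (p * p + q * r) * y = 0.
    have -> : (p * p + q * r) * y = p * (p * y) + q * (r * y) by ring.
    by rewrite py ry !mulr0 addr0.
  have h3 : (p * p + q * r) * z = 0.
    have -> : (p * p + q * r) * z = p * (p * z) + r * (q * z) by ring.
    by rewrite pz qz !mulr0 addr0.
  move/eqP: h2; rewrite mulf_eq0 (negbTE d0) => /eqP ->.
  by move/eqP: h3; rewrite mulf_eq0 (negbTE d0) => /eqP ->.
have e i j : (A *m B) i j = (B *m A) i j by rewrite AB.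
move: trA; rewrite mxtrace22E => /eqP; rewrite addr_eq0 => /eqP trA0.
have trA : A 1 1 = - A 0 0 by rewrite trA0 opprK.
have := key (A 0 0) (A 0 1) (A 1 0) (B 0 0) (B 0 1) (B 1 0) (B 1 1).
move: (e 0 0) (e 0 1) (e 1 0); move: trAB dA.
rewrite mxtrace22E !mulmx22E det22E trA => trAB dA e00 e01 e10.
case.
- by move: dA; rewrite mulrN -opprD oppr_eq0.
- by move: e00; rewrite [B 0 0 * _]mulrC => /addrI ->; rewrite mulrC.
- by rewrite e01; ring.
- by rewrite -e10; ring.
- by rewrite -trAB; ring.
move=> h1 h2 h3; apply: matrix22P; rewrite ?h1 ?h2 ?h3 !mxE //=.
Qed.

End two_by_two.

Section eigenvalues.
Context {R : realType}.

(** Read off from the coefficient of 'X^(m - 1) in the characteristic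
    polynomial. *)
Lemma type_two_trace m (S : 'M[R]_m) a b : (2 <= m)%N ->
  type_two_eigenvalues S a b -> \tr S = a + b.
Proof.
case: m S => [|[|m]] // S _ [_ _ cS].
have := char_poly_trace S isT; rewrite cS /= subSS subn1 /= coefMXn.
rewrite ltnNge leqnSn /= subSnn.
have -> : ('X - a%:P) * ('X - b%:P) = (a * b)%:P - (a + b)%:P * 'X + 'X^2.
  by rewrite polyCM polyCD; ring.
rewrite coefD coefB coefC coefMX coefC coefXn /= add0r addr0 => /oppr_inj.
by move=> ->.
Qed.

(** S is self-adjoint for the inner product with Gram matrix A A^T, so its
    range meets its kernel trivially. *)
Lemma selfadjoint_cancel m d (A : 'M[R]_(m, d)) (h P : 'M[R]_m) :
  let S := h *m invmx (A *m A^T) in row_free A -> h^T = h ->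
  S *m (S *m P) = 0 -> S *m P = 0.
Proof.
move=> S Af hT SSP; have gu : A *m A^T \in unitmx by rewrite gram_unit.
pose W := invmx (A *m A^T) *m (S *m P).
have SW : S *m P = (A *m A^T) *m W by rewrite /W mulKVmx.
have WT : W^T = P^T *m invmx (A *m A^T) *m S.
  by rewrite /W /S !trmx_mul trmx_inv trmx_mul trmxK hT !mulmxA.
clearbody W; have : (W^T *m A) *m (W^T *m A)^T = 0.
  rewrite trmx_mul trmxK mulmxA -(mulmxA _ A) -mulmxA -SW WT.
  by rewrite -(mulmxA _ S) SSP mulmx0.
move/eqP; rewrite mulmx_tr_eq0 => /eqP WA.
have : W^T = 0 by apply: (row_free_inj Af); rewrite WA mul0mx.
by move/(congr1 trmx); rewrite trmxK trmx0 SW => ->; rewrite mulmx0.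
Qed.

(** The characteristic polynomial is (X^2 - a^2) X^(m - 2). Self-adjointness
    lowers the power of S to one, so that S^3 = a^2 S, and S has trace zero.
    Unlike a choice of eigenvectors, this identity can be differentiated. *)
Lemma cube_trace0 m d (A : 'M[R]_(m, d)) (h : 'M[R]_m) a b :
  let S := h *m invmx (A *m A^T) in (3 <= m)%N -> row_free A -> h^T = h ->
  type_two_eigenvalues S a b -> a + b = 0 -> \tr (S *m S *m S) = 0.
Proof.
case: m A h => [|[|[|m]]] // A h S _ Af hT ev ab0.
have trS : \tr S = 0 by rewrite (type_two_trace _ ev).
have [_ _ cS] := ev.
have bE : b = - a by apply/eqP; rewrite -addr_eq0 addrC ab0.
pose P := S *m S - (a ^+ 2)%:M.
have SnP : S ^+ m.+1 * P = 0.
  have := Cayley_Hamilton S; rewrite cS bE.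
  have -> : ('X - a%:P) * ('X - (- a)%:P) = 'X^2 - (a ^+ 2)%:P :> {poly R}.
    by rewrite polyCN rmorphXn /=; ring.
  rewrite subn2 /= mulrC rmorphM rmorphB /= [horner_mx _ 'X^_]rmorphXn /=.
  by rewrite [horner_mx _ 'X^2]rmorphXn /= horner_mx_X horner_mx_C.
have SP : S *m P = 0.
  suff cancel k : S ^+ k.+1 * P = 0 -> S *m P = 0 by exact: cancel SnP.
  elim: k => [|k IH SkP]; first by rewrite expr1.
  apply: IH; rewrite exprS -mulrA.
  apply: (@selfadjoint_cancel _ _ A h (S ^+ k * P)) => //.
  by rewrite -/S !mulmxE mulrA mulrA -expr2 -exprD.
have -> : S *m S *m S = a ^+ 2 *: S.
  move/eqP: SP; rewrite /P mulmxBr mulmxA subr_eq0 => /eqP ->.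
  by rewrite mul_mx_scalar.
by rewrite mxtraceZ trS mulr0.
Qed.

(** The rows of J are a basis of Delta, s = J K is the matrix of the shape
    operator S on Delta, S' is the derivative of S along a direction of its
    kernel, and L is the second fundamental form of the integral surface in
    that direction; b collects terms that depend on the coordinates.

    Since S^2 is - det s times the orthogonal projection onto Delta, the trace
    of S' over Delta is a multiple of tr (S' S S) = 0. The terms in b cancel
    in the trace, because s is self-adjoint for G; hence tr (s L G^-1) = 0. As
    L and s L are symmetric, L G^-1 commutes with the traceless s, and is
    therefore scalar. *)
Lemma umbilic_algebra n (g S S' : 'M[R]_n) (J : 'M[R]_(2, n)) (K : 'M[R]_(n, 2))
    (L b : 'M[R]_2) :
  let G := J *m g *m J^T in let s := J *m K in
  g^T = g -> (S *m g)^T = S *m g -> S = K *m J -> G \in unitmx ->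
  \det s != 0 -> \tr S = 0 -> \tr (S' *m S *m S) = 0 ->
  L^T = L -> (s *m L)^T = s *m L ->
  s *m L = (J *m S' *m g *m J^T)^T + b *m s^T - s *m b ->
  exists l, L = l *: G.
Proof.
move=> G s gT hT SE Gu ds trS trS3 LT sLT sL.
have GT : G^T = G by rewrite /G !trmx_mul trmxK gT mulmxA.
have trs : \tr s = 0 by rewrite mxtrace_mulC -SE.
have ss := traceless_sqr trs.
have sG : s *m G = G *m s^T.
  have -> : s *m G = J *m (S *m g) *m J^T by rewrite SE /s /G !mulmxA.
  by rewrite -hT SE /s /G !trmx_mul gT !mulmxA.
have sGi : s^T *m invmx G = invmx G *m s.
  by rewrite -[s in RHS](mulmxK Gu) sG -(mulmxA G) mulKmx.
pose Q := g *m J^T *m invmx G *m J.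
have KE : K = g *m J^T *m invmx G *m s.
  have : J *m (S *m g) = G *m K^T.
    by rewrite -hT SE !trmx_mul gT /G !mulmxA.
  rewrite SE !mulmxA -/s => /(congr1 (mulmx (invmx G))).
  rewrite mulKmx// => /(congr1 trmx); rewrite trmxK => E; rewrite -[LHS]E.
  by rewrite trmx_mul (trmx_mul (s *m J)) (trmx_mul s) gT trmx_inv GT -!mulmxA sGi.
have trQ : \tr (S' *m Q) = 0.
  have SS : S *m S = - \det s *: Q.
    rewrite SE -mulmxA (mulmxA J) -/s {1}KE.
    by rewrite -(mulmxA _ s) (mulmxA s s) ss mul_scalar_mx /Q -scalemxAr.
  have := trS3; rewrite -mulmxA SS -scalemxAr mxtraceZ => /eqP.
  by rewrite mulf_eq0 oppr_eq0 (negbTE ds) => /eqP.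
pose M := L *m invmx G.
have sM : s *m M = M *m s.
  rewrite /M -mulmxA -sGi !mulmxA; congr (_ *m _).
  by rewrite -sLT trmx_mul LT.
have trsM : \tr (s *m M) = 0.
  rewrite /M mulmxA sL mulmxBl mulmxDl raddfB raddfD /=.
  have -> : \tr ((J *m S' *m g *m J^T)^T *m invmx G) = 0.
    rewrite -mxtrace_tr trmx_mul trmxK trmx_inv GT mxtrace_mulC -!mulmxA.
    by rewrite mxtrace_mulC -!mulmxA -trQ /Q -!mulmxA.
  have -> : \tr (b *m s^T *m invmx G) = \tr (s *m b *m invmx G).
    by rewrite -mulmxA sGi mulmxA mxtrace_mulC mulmxA.
  by rewrite add0r subrr.
have ME := commute_traceless trs ds sM trsM.
exists (M 0 0); rewrite -mul_scalar_mx -ME /M mulmxKV//.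
Qed.

End eigenvalues.

(** * Integral surfaces are umbilic in the directions of the kernel *)

Section hessian.
Context {R : realType}.

Lemma derive_eq_on (V W : normedModType R) (U : set V) (f g : V -> W) x v :
  open U -> U x -> (forall y, U y -> f y = g y) -> 'D_v f x = 'D_v g x.
Proof. by move=> oU Ux fg; apply: near_eq_derive; exact: open_near fg. Qed.

Lemma derive_mulmxl (V : normedModType R) m n p (A : 'M[R]_(m, n))
    (F : V -> 'M[R]_(n, p)) x v : differentiable F x ->
  'D_v (fun y => A *m F y) x = A *m 'D_v F x.
Proof.
by move=> dF; rewrite (derive_mulmx (F := cst A))// derive_cst mul0mx add0r.
Qed.

Lemma derive_mulmxr (V : normedModType R) m n p (A : 'M[R]_(n, p))
    (F : V -> 'M[R]_(m, n)) x v : differentiable F x ->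
  'D_v (fun y => F y *m A) x = 'D_v F x *m A.
Proof.
by move=> dF; rewrite (derive_mulmx (G := cst A))// derive_cst mulmx0 addr0.
Qed.

Lemma derive_mulmx_tr (V : normedModType R) m n p (F : V -> 'M[R]_(m, n))
    (G : V -> 'M[R]_(p, n)) x v : differentiable F x -> differentiable G x ->
  'D_v (fun y => F y *m (G y)^T) x
    = 'D_v F x *m (G x)^T + F x *m ('D_v G x)^T.
Proof.
move=> dF dG; rewrite derive_mulmx//; last exact: differentiable_trmx.
by rewrite derive_trmx.
Qed.

Lemma derive_mxtrace (V : normedModType R) n (F : V -> 'M[R]_n) x v :
  differentiable F x -> 'D_v (fun y => \tr (F y)) x = \tr ('D_v F x).
Proof.
move=> dF; rewrite (_ : (fun _ => _) = \sum_i (fun y => F y i i)).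
  rewrite derive_sum; first by apply: eq_bigr => i _; rewrite deriveE_mx.
  by move=> i; apply: diff_derivable; exact: (differentiable_mxP F x).1.
by apply/funext => y; rewrite fct_sumE.
Qed.

Lemma derive_mul_jacobian m d (U : set 'rV[R]_m) (X : 'rV[R]_m -> 'rV[R]_d)
    x a b : open U -> smooth_on U X -> U x ->
  a *m 'D_b (jacobian X) x = 'D_b ('D_a X) x.
Proof.
move=> oU sX Ux; rewrite -derive_mulmxl; last first.
  exact: smooth_differentiable (smooth_jacobian oU sX) Ux.
apply: (derive_eq_on _ oU Ux) => y Uy.
by rewrite deriveEjacobian//; exact: smooth_differentiable Uy.
Qed.

Lemma derive_jacobian_sym m d (U : set 'rV[R]_m) (X : 'rV[R]_m -> 'rV[R]_d)
    x a b : open U -> smooth_on U X -> U x ->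
  a *m 'D_b (jacobian X) x = b *m 'D_a (jacobian X) x.
Proof.
move=> oU sX Ux; rewrite (derive_mul_jacobian _ _ oU sX Ux).
rewrite (derive_mul_jacobian _ _ oU sX Ux).
exact: derive_derive_sym_mx oU sX Ux.
Qed.

Lemma row_free_mul k m d (J : 'M[R]_(k, m)) (A : 'M[R]_(m, d)) :
  row_free J -> row_free A -> row_free (J *m A).
Proof.
move=> Jf Af; rewrite -kermx_eq0 -(inj_eq (row_free_inj Jf)) mul0mx.
by rewrite -(inj_eq (row_free_inj Af)) mul0mx -mulmxA mulmx_ker.
Qed.

End hessian.

Lemma derive_opp_mulmx {R : realType} (V : normedModType R) m n p (U : set V)
    (F : V -> 'M[R]_(m, p)) (S : V -> 'M[R]_(m, n)) (A : V -> 'M[R]_(n, p)) x v :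
  open U -> U x -> differentiable S x -> differentiable A x ->
  (forall y, U y -> F y = - (S y *m A y)) ->
  'D_v F x = - ('D_v S x *m A x + S x *m 'D_v A x).
Proof.
move=> oU Ux dS dA FE; apply: (etrans (derive_eq_on _ oU Ux FE)).
rewrite -derive_mulmx//; apply: deriveN.
by apply: diff_derivable; exact: differentiable_mulmx.
Qed.

(** For t in the kernel of the shape operator S, the component along t of the
    second derivative of the normal is governed by the derivative of S along
    t. Here A and M play the jacobians of the immersion and of its unit
    normal: differentiate the symmetry of dN . dX along b, pair it with a and
    t, exchange the order of the second derivatives, and differentiate M = - S
    A along t. *)
Lemma normal_hessian_formula {R : realType} n d (U : set 'rV[R]_n)
    (A M : 'rV[R]_n -> 'M[R]_(n, d)) (S : 'rV[R]_n -> 'M[R]_n)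
    x (a b t : 'rV[R]_n) : open U -> U x ->
  differentiable A x -> differentiable M x -> differentiable S x ->
  (forall y, U y -> M y = - (S y *m A y)) ->
  (forall y, U y -> M y *m (A y)^T = A y *m (M y)^T) ->
  (forall a b, a *m 'D_b A x = b *m 'D_a A x) ->
  (forall a b, a *m 'D_b M x = b *m 'D_a M x) ->
  t *m S x = 0 ->
  a *m ('D_b M x *m (A x)^T) *m t^T =
    - (a *m (A x *m (A x)^T) *m ('D_t S x)^T *m b^T)
    - a *m (A x *m ('D_t A x)^T) *m (S x)^T *m b^T
    + a *m S x *m (A x *m ('D_t A x)^T) *m b^T.
Proof.
move=> oU Ux dA dM dS MS MA symA symM tS.
have Mt := derive_opp_mulmx t oU Ux dS dA MS.
have tM : t *m M x = 0 by rewrite MS// mulmxN mulmxA tS mul0mx oppr0.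
have sym : 'D_b M x *m (A x)^T + M x *m ('D_b A x)^T =
           'D_b A x *m (M x)^T + A x *m ('D_b M x)^T.
  have e1 := derive_mulmx_tr b dM dA.
  have e2 := derive_mulmx_tr b dA dM.
  exact: etrans (esym e1) (etrans (derive_eq_on b oU Ux MA) e2).
move: (symA t b) (symM t b) (MS x Ux) Mt tM sym.
move: ('D_b A x) ('D_b M x) ('D_t A x) ('D_t M x) ('D_t S x) (A x) (M x) (S x).
move=> Ab Mb At Mt St A0 M0 S0 tAb tMb M0E MtE tM0 e.
have {e} -> : Mb *m A0^T = Ab *m M0^T + A0 *m Mb^T - M0 *m Ab^T.
  by rewrite -e addrK.
have t1 : M0^T *m t^T = 0 by rewrite -trmx_mul tM0 trmx0.
have t2 : Mb^T *m t^T = Mt^T *m b^T by rewrite -!trmx_mul tMb.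
have t3 : Ab^T *m t^T = At^T *m b^T by rewrite -!trmx_mul tAb.
rewrite -mulmxA mulmxBl mulmxDl -!mulmxA t1 t2 t3 mulmx0 add0r MtE M0E.
have -> : (- (St *m A0 + S0 *m At))^T = - (A0^T *m St^T + At^T *m S0^T).
  by rewrite linearN linearD /= !trmx_mul.
rewrite mulNmx mulmxDl mulmxN mulmxDr mulNmx opprK mulmxDr mulmxN mulmxDr opprD.
by rewrite -!mulmxA.
Qed.

Lemma derive_mulmx_comp {R : realType} (V : normedModType R) n p q r (D : set V)
    (F : V -> 'M[R]_(p, r)) (J : V -> 'M[R]_(p, q)) (phi : V -> 'rV[R]_n)
    (M : 'rV[R]_n -> 'M[R]_(q, r)) x v : open D -> D x ->
  (forall y, D y -> F y = J y *m M (phi y)) ->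
  differentiable J x -> differentiable phi x -> differentiable M (phi x) ->
  'D_v F x = 'D_v J x *m M (phi x) + J x *m 'D_('D_v phi x) M (phi x).
Proof.
move=> oD Dx FE dJ dphi dM.
have dMphi : differentiable (M \o phi) x by exact: differentiable_comp.
have e1 := derive_eq_on v oD Dx FE.
have e2 := derive_mulmx v dJ dMphi.
have e3 := derive_comp v dphi dM.
pose sum C := 'D_v J x *m M (phi x) + J x *m C.
exact: etrans e1 (etrans e2 (congr1 sum e3)).
Qed.

Lemma signed_sum_entry {R : realType} m n p (P1 P2 P3 : 'M[R]_(m, n))
    (Q : 'M[R]_(p, n)) i j :
  (- (row i P1 *m (row j Q)^T) - row i P2 *m (row j Q)^T
     + row i P3 *m (row j Q)^T) 0 0
  = (- (P1 *m Q^T) - P2 *m Q^T + P3 *m Q^T) i j.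
Proof.
rewrite -!mulNmx -!mulmxDl -[RHS]mulmx_row_tr; congr ((_ *m _) 0 0).
by apply/rowP => k; rewrite !mxE.
Qed.

Section hypersurface.
Context {R : realType} {n : nat}.
Context (U : set 'rV[R]_n) (X N : 'rV[R]_n -> 'rV[R]_n.+1).
Context (rX : regular_patch U X) (uN : unit_normal (fun=> setT) U X N).

Let A := jacobian X.
Let M := jacobian N.
Let S := shape_op X N.

Let oU : open U. Proof. by case: rX. Qed.
Let sX : smooth_on U X. Proof. by case: rX. Qed.
Let sN : smooth_on U N. Proof. by case: uN. Qed.
Let sA : smooth_on U A. Proof. exact: smooth_jacobian. Qed.
Let sM : smooth_on U M. Proof. exact: smooth_jacobian. Qed.
Let Af y : U y -> row_free (A y). Proof. by case: rX => _ _; exact. Qed.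

Let XN y : U y -> A y *m (N y)^T = 0.
Proof. by case: uN => _ H /H[_ _]; exact: jacobian_normal0. Qed.

Lemma shape_op_gramE y : U y -> S y *m (A y *m (A y)^T) = second_ff X N y.
Proof.
move=> Uy; rewrite /S /shape_op first_ffE ?mulmxKV ?gram_unit//; first exact: Af.
exact: smooth_differentiable Uy.
Qed.

Lemma shape_op_selfadjoint y : U y ->
  (S y *m (A y *m (A y)^T))^T = S y *m (A y *m (A y)^T).
Proof. by move=> Uy; rewrite shape_op_gramE// (second_ff_sym N oU sX). Qed.

Lemma normal_jacobian_sym y : U y -> M y *m (A y)^T = A y *m (M y)^T.
Proof.
move=> Uy; have := second_ff_sym N oU sX Uy.
rewrite (second_ffE oU sX sN XN Uy) linearN /= trmx_mul trmxK.
by move=> /oppr_inj.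
Qed.

Lemma smooth_shape_op : smooth_on U S.
Proof.
have s1 : smooth_on U (fun y => - (A y *m (M y)^T)).
  apply: smooth_opp => //; apply: smooth_mulmx => //; exact: smooth_trmx.
have s2 : smooth_on U (fun y => invmx (A y *m (A y)^T)).
  apply: smooth_invmx => //; first by move=> y Uy; rewrite gram_unit; exact: Af.
  by apply: smooth_mulmx => //; exact: smooth_trmx.
apply: (smooth_eq oU _ (smooth_mulmx oU s1 s2)) => y Uy.
rewrite /S /shape_op (second_ffE oU sX sN XN Uy) first_ffE//.
exact: smooth_differentiable Uy.
Qed.

Lemma shape_op_traces y : (3 <= n)%N -> type_number_two U X N ->
  minimal_type_two U X N -> U y ->
  \tr (S y) = 0 /\ \tr (S y *m S y *m S y) = 0.
Proof.
move=> n3 [_ _ ev] minX Uy; have [a [b e]] := ev y Uy.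
have ab0 := minX y a b Uy e; split.
  by rewrite (type_two_trace (ltnW n3) e).
have SE : S y = second_ff X N y *m invmx (A y *m (A y)^T).
  by rewrite /S /shape_op first_ffE//; exact: smooth_differentiable Uy.
rewrite -/(S y) SE in e; rewrite SE.
exact: (cube_trace0 n3 (Af Uy) (second_ff_sym N oU sX Uy) e ab0).
Qed.

(** S is self-adjoint, so its range lies in Delta, which is spanned by the
    rows of jacobian phi. On Delta, the orthogonal complement of its kernel, S
    is injective. *)
Lemma integral_surface_factor D phi q : integral_surface U X N D phi -> D q ->
  exists K : 'M[R]_(n, 2), S (phi q) = K *m jacobian phi q /\
    \det (jacobian phi q *m K) != 0.
Proof.
move=> [[oD sphi phif] DU HD] Dq; have Uq := DU q Dq.
have SJ : (S (phi q) <= jacobian phi q)%MS.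
  apply/row_subP => i; apply/(HD q Dq) => w wS; apply/dot_eq0.
  have e : S (phi q) *m (A (phi q) *m (A (phi q))^T) *m w^T = 0.
    by rewrite -(shape_op_selfadjoint Uq) -trmx_mul mulmxA wS mul0mx trmx0.
  by rewrite trmx_mul mulmxA -!row_mul -(mulmxA (S _)) e row0.
have [K SE] := submxP SJ; exists K; split=> //.
rewrite -unitfE -unitmxE -row_free_unit -kermx_eq0.
have := mulmx_ker (jacobian phi q *m K); move: (kermx _) => u us.
have uS : u *m jacobian phi q *m S (phi q) = 0.
  by rewrite SE mulmxA -(mulmxA u) us mul0mx.
have : u *m jacobian phi q *m A (phi q) = 0.
  apply/row_matrixP => i; rewrite row0; apply/eqP.
  rewrite -mulmx_tr_eq0; apply/eqP/dot_eq0; rewrite !row_mul.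
  have H : Delta X N (phi q) (row i u *m jacobian phi q).
    by apply/(HD q Dq); exact: submxMl.
  by apply: (H (row i u *m jacobian phi q)); rewrite -!row_mul uS row0.
move/eqP; rewrite -(mul0mx _ (A (phi q))) (inj_eq (row_free_inj (Af Uq))).
by rewrite -(mul0mx _ (jacobian phi q)) (inj_eq (row_free_inj (phif q Dq))).
Qed.

Section integral_surface.
Context (D : set 'rV[R]_2) (phi : 'rV[R]_2 -> 'rV[R]_n).
Context (iphi : integral_surface U X N D phi).

Let z := X \o phi.
Let nu := N \o phi.

Let oD : open D. Proof. by case: iphi => -[]. Qed.
Let sphi : smooth_on D phi. Proof. by case: iphi => -[]. Qed.
Let phif q : D q -> row_free (jacobian phi q).
Proof. by case: iphi => -[_ _ H] _ _; exact: H. Qed.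
Let DU q : D q -> U (phi q). Proof. by case: iphi => _ H _; exact: H. Qed.

Let smooth_z : smooth_on D z. Proof. exact: smooth_comp sphi sX. Qed.
Let smooth_nu : smooth_on D nu. Proof. exact: smooth_comp sphi sN. Qed.

Let jac_z q : D q -> jacobian z q = jacobian phi q *m A (phi q).
Proof.
move=> Dq; apply: jacobian_comp; first exact: smooth_differentiable Dq.
exact: smooth_differentiable sX (DU Dq).
Qed.

Let jac_nu q : D q -> jacobian nu q = jacobian phi q *m M (phi q).
Proof.
move=> Dq; apply: jacobian_comp; first exact: smooth_differentiable Dq.
exact: smooth_differentiable sN (DU Dq).
Qed.

Lemma integral_surface_patch : regular_patch D z.
Proof.
split=> // q Dq; rewrite jac_z//.
by apply: row_free_mul; [exact: phif|exact/Af/DU].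
Qed.

Lemma integral_surface_normal : unit_normal (fun=> setT) D z nu.
Proof.
split=> // q Dq; have [_ HN] := uN; have [_ NN NX] := HN _ (DU Dq).
by split=> // v; rewrite jac_z// mulmxA; exact: NX.
Qed.

Lemma integral_surface_weingarten q K : D q ->
  S (phi q) = K *m jacobian phi q ->
  jacobian nu q = - (jacobian phi q *m K *m jacobian z q).
Proof.
move=> Dq SE; rewrite jac_nu// jac_z//.
have -> : M (phi q) = - (S (phi q) *m A (phi q)).
  exact: (weingarten rX uN (DU Dq)).
by rewrite SE mulmxN !mulmxA.
Qed.

(** The matrix of S on the tangent planes of the surface, expressed through z
    and nu so that its smoothness is apparent. *)
Let W q := - (jacobian nu q *m (jacobian z q)^T
               *m invmx (jacobian z q *m (jacobian z q)^T)).

Let WE q K : D q -> S (phi q) = K *m jacobian phi q ->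
  W q = jacobian phi q *m K.
Proof.
move=> Dq SE; have [_ _ zf] := integral_surface_patch.
rewrite /W (integral_surface_weingarten Dq SE) !mulNmx opprK.
by rewrite -(mulmxA _ (jacobian z q)) mulmxK// gram_unit; exact: zf.
Qed.

Let smooth_W : smooth_on D W.
Proof.
have sZ := smooth_jacobian oD smooth_z; have sV := smooth_jacobian oD smooth_nu.
have sZT := smooth_trmx oD sZ.
apply: smooth_opp => //; apply: smooth_mulmx => //; first exact: smooth_mulmx.
apply: smooth_invmx => //; last exact: smooth_mulmx.
by have [_ _ zf] := integral_surface_patch => q /zf; rewrite gram_unit.
Qed.

Lemma integral_surface_shape_op q K : D q -> S (phi q) = K *m jacobian phi q ->
  shape_op z nu q = jacobian phi q *m K.
Proof.
move=> Dq SE; have [_ _ zf] := integral_surface_patch.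
rewrite -(WE Dq SE) /W /shape_op first_ffE; last first.
  exact: smooth_differentiable smooth_z Dq.
rewrite -mulNmx; congr (_ *m _); rewrite -(second_ff_sym nu oD smooth_z Dq).
rewrite (second_ffE oD smooth_z smooth_nu _ Dq).
  by rewrite linearN /= trmx_mul trmxK.
by have [_ H] := integral_surface_normal => y /H[_ _]; exact: jacobian_normal0.
Qed.

Lemma integral_surface_minimal q : (3 <= n)%N -> type_number_two U X N ->
  minimal_type_two U X N -> D q -> \tr (shape_op z nu q) = 0.
Proof.
move=> n3 tX mX Dq; have [K [SE _]] := integral_surface_factor iphi Dq.
rewrite (integral_surface_shape_op Dq SE) mxtrace_mulC -SE.
by have [] := shape_op_traces n3 tX mX (DU Dq).
Qed.

(** Being tangent to the hypersurface, T is t A with t in the kernel of S. The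
    component along T of the second derivative of nu is - W L by the
    Weingarten equation of the surface, and is also given by
    normal_hessian_formula because nu = N o phi; comparing the two provides
    the hypothesis of umbilic_algebra. *)
Lemma integral_surface_umbilic q (T : 'rV[R]_n.+1) : (3 <= n)%N ->
  type_number_two U X N -> minimal_type_two U X N -> D q ->
  jacobian z q *m T^T = 0 -> nu q *m T^T = 0 ->
  exists l, forall i j, (row i ('D_('e_j) (jacobian z) q) *m T^T) 0 0 =
    l * (jacobian z q *m (jacobian z q)^T) i j.
Proof.
move=> n3 tX mX Dq ZT nuT; have Uq := DU Dq.
have [K [SE dsK]] := integral_surface_factor iphi Dq.
set x := phi q in SE *; set J := jacobian phi q in SE dsK *.
have sZ := smooth_jacobian oD smooth_z; have sV := smooth_jacobian oD smooth_nu.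
have sJ := smooth_jacobian oD sphi.
have dZ : differentiable (jacobian z) q by exact: smooth_differentiable Dq.
have dV : differentiable (jacobian nu) q by exact: smooth_differentiable Dq.
have dJ : differentiable (jacobian phi) q by exact: smooth_differentiable Dq.
have dphi : differentiable phi q by exact: smooth_differentiable Dq.
have dA : differentiable A x by exact: smooth_differentiable Uq.
have dM : differentiable M x by exact: smooth_differentiable Uq.
have dS : differentiable S x by exact: smooth_differentiable smooth_shape_op Uq.
have dW : differentiable W q by exact: smooth_differentiable Dq.
have Nf : row_free (N x).
  by have [_ /(_ _ Uq)[_ NN _]] := uN; exact: unit_row_free.
have [t TE] : exists t, T = t *m A x.
  apply/submxP; apply: (sub_orthogonal (add1n n) Nf (Af Uq)).
    by rewrite -[LHS]trmxK trmx_mul trmxK XN// trmx0.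
  by rewrite -[LHS]trmxK trmx_mul trmxK nuT trmx0.
pose g := A x *m (A x)^T.
have gT : g^T = g by exact: trmx_gram.
have gu : g \in unitmx by rewrite gram_unit; exact: Af.
have JgT : J *m g *m t^T = 0.
  by move: ZT; rewrite TE jac_z// trmx_mul !mulmxA.
have tS : t *m S x = 0.
  have : t *m (S x *m g) = 0.
    rewrite -(shape_op_selfadjoint Uq) -[LHS]trmxK trmx_mul trmxK.
    by rewrite SE -(mulmxA K) -(mulmxA K) JgT mulmx0 trmx0.
  by rewrite mulmxA => /(congr1 (mulmx^~ (invmx g))); rewrite mulmxK// mul0mx.
have MTt : M x *m (A x)^T *m t^T = 0.
  rewrite (normal_jacobian_sym Uq).
  have -> : M x = - (S x *m A x) by exact: (weingarten rX uN Uq).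
  by rewrite linearN /= trmx_mul mulmxN mulNmx -!mulmxA -trmx_mul tS trmx0
    !mulmx0 oppr0.
pose s := J *m K.
pose St := 'D_t S x.
pose B := A x *m ('D_t A x)^T.
pose L := \matrix_(i, j) (row i ('D_('e_j) (jacobian z) q) *m T^T) 0 0.
pose Om := \matrix_(i, j) (row i ('D_('e_j) (jacobian nu) q) *m T^T) 0 0.
have LT : L^T = L.
  apply/matrixP => i j; rewrite !mxE !rowE.
  by rewrite (derive_jacobian_sym _ _ oD smooth_z Dq).
have OmT : Om^T = Om.
  apply/matrixP => i j; rewrite !mxE !rowE.
  by rewrite (derive_jacobian_sym _ _ oD smooth_nu Dq).
have VW y : D y -> jacobian nu y = - (W y *m jacobian z y).
  move=> Dy; have [K' [SE' _]] := integral_surface_factor iphi Dy.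
  by rewrite (WE Dy SE') (integral_surface_weingarten Dy SE').
(* the second derivative of nu from the Weingarten equation of the surface *)
have OmL : Om = - (s *m L).
  have e j : 'D_('e_j) (jacobian nu) q *m T^T =
      - (s *m ('D_('e_j) (jacobian z) q *m T^T)).
    have dVE := derive_opp_mulmx 'e_j oD Dq dW dZ VW.
    apply: (etrans (congr1 (mulmx^~ T^T) dVE)).
    move: ('D_('e_j) W q) ('D_('e_j) (jacobian z) q) => W' Z'.
    by rewrite (WE Dq SE) mulNmx mulmxDl -mulmxA ZT mulmx0 add0r mulmxA.
  apply/matrixP => i j; rewrite [LHS]mxE -row_mul e [RHS]mxE [(s *m L) i j]mxE.
  rewrite [LHS]mxE [LHS]mxE mxE; congr (- _); apply: eq_bigr => k _.
  by rewrite [L k j]mxE -row_mul [row _ _ _ _]mxE.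
(* the same second derivative from nu = N o phi *)
have OmE : Om = - (J *m St *m g *m J^T)^T - J *m B *m J^T *m s^T
    + s *m (J *m B *m J^T).
  have e j : 'D_('e_j) (jacobian nu) q *m T^T =
      J *m ('D_(row j J) M x *m (A x)^T *m t^T).
    have dVE : 'D_('e_j) (jacobian nu) q =
        'D_('e_j) (jacobian phi) q *m M x + J *m 'D_(row j J) M x.
      apply: (etrans (derive_mulmx_comp _ oD Dq jac_nu dJ dphi dM)).
      by rewrite /J row_jacobian.
    apply: (etrans (congr1 (mulmx^~ T^T) dVE)).
    move: ('D_('e_j) (jacobian phi) q) ('D_(row j J) M x) => J' M'.
    rewrite mulmxDl TE trmx_mul -!mulmxA (mulmxA (M x)) MTt mulmx0 add0r.
    by rewrite !mulmxA.
  have f a b := @normal_hessian_formula _ _ _ U A M S x a b t oU Uq dA dM dS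
    (fun y Uy => weingarten rX uN Uy) normal_jacobian_sym
    (fun a b => derive_jacobian_sym a b oU sX Uq)
    (fun a b => derive_jacobian_sym a b oU sN Uq) tS.
  apply/matrixP => i j; rewrite [LHS]mxE -row_mul e row_mul mulmxA.
  apply: (etrans (congr1 (fun C : 'M[R]_(1, 1) => C 0 0) (f _ _))).
  have sJ' : s *m J = J *m S x by rewrite /s SE mulmxA.
  have -> : (J *m St *m g *m J^T)^T = J *m g *m St^T *m J^T.
    by rewrite trmx_mul trmxK (trmx_mul _ g) (trmx_mul J) gT !mulmxA.
  have -> : J *m B *m J^T *m s^T = J *m B *m (S x)^T *m J^T.
    by rewrite -mulmxA -trmx_mul sJ' trmx_mul !mulmxA.
  have -> : s *m (J *m B *m J^T) = J *m S x *m B *m J^T.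
    by rewrite (mulmxA s) (mulmxA s) sJ'.
  by rewrite -[RHS]signed_sum_entry !row_mul.
have trS3 : \tr (St *m S x *m S x) = 0.
  have tr0 : 'D_t (fun y => \tr (S y *m S y *m S y)) x = 0.
    rewrite -(derive_cst (0 : R) x t); apply: (derive_eq_on _ oU Uq) => y Uy.
    by have [] := shape_op_traces n3 tX mX Uy.
  have dSS : differentiable (fun y => S y *m S y) x by exact: differentiable_mulmx.
  have dSSS : differentiable (fun y => S y *m S y *m S y) x.
    exact: (differentiable_mulmx dSS dS).
  have e1 := derive_mxtrace t dSSS.
  have e2 := derive_mulmx t dSS dS.
  have e3 := derive_mulmx t dS dS.
  move: e1; rewrite tr0 e2 e3 -/St; clear -R; move: St (S x) => C E.
  rewrite mulmxDl !mxtraceD -(mulmxA E C) (mxtrace_mulC E (C *m E)).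
  rewrite (mxtrace_mulC (E *m E)) (mulmxA C) => e.
  have : 3%:R * \tr (C *m E *m E) = 0 by rewrite [RHS]e; ring.
  by move/eqP; rewrite mulf_eq0 pnatr_eq0 => /eqP.
have hT : (S x *m g)^T = S x *m g by exact: shape_op_selfadjoint.
have GE : J *m g *m J^T = jacobian z q *m (jacobian z q)^T.
  by rewrite jac_z// trmx_mul /g !mulmxA.
have Gu : J *m g *m J^T \in unitmx.
  by rewrite GE gram_unit; have [_ _] := integral_surface_patch; exact.
have [trS _] := shape_op_traces n3 tX mX Uq.
have sLE : s *m L = - Om by rewrite OmL opprK.
have sLT : (s *m L)^T = s *m L by rewrite sLE linearN /= OmT.
have sL : s *m L = (J *m St *m g *m J^T)^T + J *m B *m J^T *m s^T
    - s *m (J *m B *m J^T).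
  by rewrite sLE OmE !opprD !opprK.
have [l Ll] : exists l, L = l *: (J *m g *m J^T).
  clear -gT hT SE Gu dsK trS trS3 LT sLT sL.
  move: (S x) St L B g gT hT SE Gu dsK trS trS3 LT sLT sL.
  move=> Sx S' L' B' g gT hT SE Gu dsK trS trS3 LT sLT sL.
  exact: (umbilic_algebra gT hT SE Gu dsK trS trS3 LT sLT sL).
exists l => i j; have /matrixP/(_ i j) := Ll.
by rewrite [L i j]mxE [RHS]mxE GE.
Qed.

End integral_surface.
End hypersurface.

(** * Orthogonal projections and the Codazzi equation *)

Section dot_theory.
Context {R : realType} {d : nat}.
Implicit Types u v w : 'rV[R]_d.

Lemma dotC u v : dot u v = dot v u.
Proof. by apply: eq_bigr => i _; rewrite mulrC. Qed.

Lemma dotDl u v w : dot (u + v) w = dot u w + dot v w.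
Proof. by rewrite -big_split; apply: eq_bigr => i _; rewrite mxE mulrDl. Qed.

Lemma dotZl a u w : dot (a *: u) w = a * dot u w.
Proof. by rewrite mulr_sumr; apply: eq_bigr => i _; rewrite mxE mulrA. Qed.

Lemma dot0l w : dot 0 w = 0.
Proof. by rewrite -(scale0r 0) dotZl mul0r. Qed.

Lemma dot_self_eq0 u : dot u u = 0 -> u = 0.
Proof. by move=> /dot_eq0/eqP; rewrite mulmx_tr_eq0 => /eqP. Qed.

Lemma derive_dot (V : normedModType R) (f g : V -> 'rV[R]_d) (x v : V) :
  differentiable f x -> differentiable g x ->
  'D_v (fun y => dot (f y) (g y)) x
    = dot ('D_v f x) (g x) + dot (f x) ('D_v g x).
Proof.
move=> df dg; rewrite !dotE.
rewrite (_ : (fun _ => _) = fun y => (f y *m (g y)^T) 0 0); last first.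
  by apply/funext => y; rewrite dotE.
rewrite -deriveE_mx; last first.
  by apply: differentiable_mulmx => //; exact: differentiable_trmx.
by rewrite derive_mulmx_tr// mxE.
Qed.

Lemma differentiable_dot (V : normedModType R) (f g : V -> 'rV[R]_d) x :
  differentiable f x -> differentiable g x ->
  differentiable (fun y => dot (f y) (g y)) x.
Proof.
move=> df dg; rewrite (_ : (fun _ => _) = fun y => (f y *m (g y)^T) 0 0).
  apply: (differentiable_mxP (fun y => f y *m (g y)^T) x).1.
  by apply: differentiable_mulmx => //; exact: differentiable_trmx.
by apply/funext => y; rewrite dotE.
Qed.

Lemma derive_scalemx (V : normedModType R) (a : V -> R) m n
    (F : V -> 'M[R]_(m, n)) (x v : V) : differentiable a x -> differentiable F x ->
  'D_v (fun y => a y *: F y) x = 'D_v a x *: F x + a x *: 'D_v F x.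
Proof.
move=> da dF; have dFij i j := (differentiable_mxP F x).1 dF i j.
have daF i j : (fun y => (a y *: F y) i j) = a * (fun y => F y i j).
  by apply/funext => y; rewrite mxE.
have daf : differentiable (fun y => a y *: F y) x.
  by apply/differentiable_mxP => i j; rewrite daF; exact: differentiableM.
apply/matrixP => i j; rewrite deriveE_mx// daF deriveM; first last.
- exact: diff_derivable.
- exact: diff_derivable.
rewrite -(deriveE_mx _ i j dF); move: ('D_v F x) ('D_v a x) => F' a'.
by rewrite !mxE addrC; congr (_ + _); exact: mulrC.
Qed.

End dot_theory.

(** The orthogonal projection onto the row space of F, when the rows of F are
    independent. *)
Definition proj_row {R : realType} k d (F : 'M[R]_(k, d)) : 'M[R]_d :=
  F^T *m invmx (F *m F^T) *m F.

Section projection.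
Context {R : realType} {k d : nat}.
Implicit Types F : 'M[R]_(k, d).

Lemma proj_row_tr F : (proj_row F)^T = proj_row F.
Proof. by rewrite /proj_row !trmx_mul trmxK trmx_inv trmx_gram mulmxA. Qed.

Lemma mul_proj_row F : row_free F -> F *m proj_row F = F.
Proof.
by rewrite -gram_unit => Fu; rewrite /proj_row !mulmxA mulmxV// mul1mx.
Qed.

Lemma proj_row_idem F : row_free F -> proj_row F *m proj_row F = proj_row F.
Proof. by move=> Ff; rewrite {1}/proj_row -mulmxA mul_proj_row. Qed.

Lemma sub_proj_row p (v : 'M[R]_(p, d)) F : v *m proj_row F = v -> (v <= F)%MS.
Proof. by move=> <-; rewrite /proj_row mulmxA submxMl. Qed.

Lemma proj_row_sub p (v : 'M[R]_(p, d)) F : row_free F -> (v <= F)%MS ->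
  v *m proj_row F = v.
Proof. by move=> Ff /submxP[C ->]; rewrite -mulmxA mul_proj_row. Qed.

Lemma mul_proj_row_eq0 p (v : 'M[R]_(p, d)) F :
  v *m F^T = 0 -> v *m proj_row F = 0.
Proof. by move=> vF; rewrite /proj_row !mulmxA vF !mul0mx. Qed.

Lemma smooth_proj_row (V : normedModType R) (D : set V) (F : V -> 'M[R]_(k, d)) :
  open D -> smooth_on D F -> (forall q, D q -> row_free (F q)) ->
  smooth_on D (fun q => proj_row (F q)).
Proof.
move=> oD sF Ff; have sFT := smooth_trmx oD sF.
apply: smooth_mulmx => //; apply: smooth_mulmx => //.
apply: smooth_invmx => //; first by move=> q /Ff; rewrite gram_unit.
exact: smooth_mulmx.
Qed.

(** Differentiating F P = F and P P = P gives P P' = 0 and P' = P' P + P P';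
    transposing, the symmetric P' vanishes. *)
Lemma derive_proj_row0 (V : normedModType R) (D : set V) (F : V -> 'M[R]_(k, d))
    q v : open D -> smooth_on D F -> (forall q, D q -> row_free (F q)) -> D q ->
  'D_v F q *m proj_row (F q) = 'D_v F q ->
  'D_v (fun q => proj_row (F q)) q = 0.
Proof.
move=> oD sF Ff Dq Fv.
have dP : differentiable (fun q => proj_row (F q)) q.
  exact: smooth_differentiable (smooth_proj_row oD sF Ff) Dq.
have dF : differentiable F q by exact: smooth_differentiable Dq.
have FP y : D y -> F y *m proj_row (F y) = F y by move=> /Ff; exact: mul_proj_row.
have PP y : D y -> proj_row (F y) *m proj_row (F y) = proj_row (F y).
  by move=> /Ff; exact: proj_row_idem.
have := etrans (esym (derive_mulmx v dF dP)) (derive_eq_on v oD Dq FP).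
have := etrans (esym (derive_mulmx v dP dP)) (derive_eq_on v oD Dq PP).
have := etrans (esym (derive_trmx v dP))
  (derive_eq_on v oD Dq (fun y _ => proj_row_tr (F y))).
rewrite Fv; move: ('D_v _ q) ('D_v F q) => P' F' P'T P'P FP'.
have PP'0 : proj_row (F q) *m P' = 0.
  rewrite /proj_row -mulmxA; have -> : F q *m P' = 0.
    by apply: (addrI F'); rewrite FP' addr0.
  by rewrite mulmx0.
rewrite -P'P PP'0 addr0 -[LHS]trmxK trmx_mul P'T proj_row_tr PP'0.
by rewrite trmx0.
Qed.

End projection.

(** The Codazzi equation. z1 and z2 are the first and second derivatives of a
    surface, Q projects onto the orthogonal complement of its tangent plane
    and of nu, and the component of z2 there is G H. Differentiating z2 Q = G
    H expresses the third derivative, projected by Q, as a totally symmetric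
    multiple of H plus G i j times the projection of the derivative of H along
    e k. Symmetry in j and k, with G invertible, forces that projection to
    vanish. *)
Lemma mean_curvature_parallel {R : realType} (V : normedModType R) d (D : set V)
    (q : V) (e : 'I_2 -> V) (z1 : 'I_2 -> V -> 'rV[R]_d)
    (z2 : 'I_2 -> 'I_2 -> V -> 'rV[R]_d) (nu H : V -> 'rV[R]_d)
    (Q : V -> 'M[R]_d) :
  let G i j y := dot (z1 i y) (z1 j y) in
  open D -> D q -> (forall i, differentiable (z1 i) q) ->
  (forall i j, differentiable (z2 i j) q) -> differentiable nu q ->
  differentiable H q -> differentiable Q q ->
  (forall i j y, D y -> z2 i j y *m Q y = G i j y *: H y) ->
  (forall i y, D y -> z1 i y *m Q y = 0) ->
  (forall y, D y -> nu y *m Q y = 0) ->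
  (forall y, D y -> H y *m Q y = H y) ->
  (forall i k, 'D_(e k) (z1 i) q = z2 i k q) ->
  (forall i j k, 'D_(e k) (z2 i j) q = 'D_(e j) (z2 i k) q) ->
  (forall i j, z2 i j q = z2 j i q) ->
  (forall k, 'D_(e k) nu q *m Q q = 0) ->
  (forall i j, exists c0 c1 h, z2 i j q
     = c0 *: z1 0 q + c1 *: z1 1 q + h *: nu q + G i j q *: H q) ->
  (forall i, dot (nu q) (z1 i q) = 0) -> (forall i, dot (H q) (z1 i q) = 0) ->
  G 0 0 q * G 1 1 q - G 0 1 q * G 1 0 q != 0 ->
  forall k, 'D_(e k) H q *m Q q = 0.
Proof.
move=> G oD Dq dz1 dz2 dnu dH dQ z2Q z1Q nuQ HQ z1' z2' z2s nu' dec nz Hz G0.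
have dG i j : differentiable (G i j) q by exact: differentiable_dot.
have G' i j k : 'D_(e k) (G i j) q =
    dot (z2 i k q) (z1 j q) + dot (z1 i q) (z2 j k q).
  by rewrite -!z1'; exact: derive_dot.
pose Q' k := 'D_(e k) Q q.
have z1Q' l k : z1 l q *m Q' k = - (G l k q *: H q).
  have := derive_eq_on (e k) oD Dq (z1Q l); rewrite derive_cst => E.
  have := etrans (esym (derive_mulmx (e k) (dz1 l) dQ)) E.
  rewrite z1' z2Q//; move/eqP; rewrite addrC addr_eq0 => /eqP; exact.
have nuQ' k : nu q *m Q' k = 0.
  have := derive_eq_on (e k) oD Dq nuQ; rewrite derive_cst => E.
  by have := etrans (esym (derive_mulmx (e k) dnu dQ)) E; rewrite nu' add0r.
have HQ' k : 'D_(e k) H q *m Q q + H q *m Q' k = 'D_(e k) H q.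
  exact: etrans (esym (derive_mulmx (e k) dH dQ)) (derive_eq_on (e k) oD Dq HQ).
pose T i j k := dot (z2 i j q) (z1 k q) + dot (z2 i k q) (z1 j q)
   + dot (z1 i q) (z2 j k q).
have key i j k : 'D_(e k) (z2 i j) q *m Q q =
    T i j k *: H q + G i j q *: ('D_(e k) H q *m Q q).
  have E1 := derive_mulmx (e k) (dz2 i j) dQ.
  have E2 := derive_scalemx (e k) (dG i j) dH.
  have := etrans (esym E1) (etrans (derive_eq_on (e k) oD Dq (z2Q i j)) E2).
  have [c0 [c1 [h zE]]] := dec i j.
  have zz : dot (z2 i j q) (z1 k q) = c0 * G 0 k q + c1 * G 1 k q.
    by rewrite zE !dotDl !dotZl nz Hz !mulr0 !addr0.
  move=> E; rewrite -[LHS](addrK (z2 i j q *m 'D_(e k) Q q)) E -/(Q' k).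
  rewrite {1}zE !mulmxDl -!scalemxAl !z1Q' nuQ' scaler0 addr0 G' -[in LHS]HQ'.
  rewrite /T zz; move: (H q) ('D_(e k) H q *m Q q) (H q *m Q' k) => h1 h2 h3.
  by apply/matrixP => a b; rewrite !mxE; ring.
have TS i j k : T i j k = T i k j.
  rewrite /T (z2s j k) [dot (z2 i j q) _ + _]addrC; congr (_ + _ + _).
have eta i j k : G i j q *: ('D_(e k) H q *m Q q) =
    G i k q *: ('D_(e j) H q *m Q q).
  have := etrans (esym (key i j k))
    (etrans (congr1 (mulmx^~ (Q q)) (z2' i j k)) (key i k j)).
  by rewrite TS => /addrI.
have cramer (a b c c' : R) (y0 y1 : 'rV[R]_d) : a *: y1 = b *: y0 ->
    c *: y1 = c' *: y0 ->
    (a * c' - b * c) *: y0 = 0 /\ (a * c' - b * c) *: y1 = 0.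
  move=> ab cc'; split.
    have -> : (a * c' - b * c) *: y0 = a *: (c' *: y0) - c *: (b *: y0).
      by rewrite !scalerA -scalerBl; congr (_ *: _); ring.
    by rewrite -ab -cc' !scalerA mulrC subrr.
  have -> : (a * c' - b * c) *: y1 = c' *: (a *: y1) - b *: (c *: y1).
    by rewrite !scalerA -scalerBl; congr (_ *: _); ring.
  by rewrite ab cc' !scalerA mulrC subrr.
have [h0 h1] := cramer _ _ _ _ _ _ (eta 0 0 1) (eta 1 0 1).
move=> k; have : k = 0 \/ k = 1.
  by case: k => [[|[|//]] lt]; [left|right]; apply: val_inj.
by case=> ->; apply/eqP; [move/eqP: h0|move/eqP: h1];
  rewrite scaler_eq0 (negbTE G0).
Qed.

(** * Surfaces with umbilic normal directions lie in a space form *)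

Lemma derive0_dirs {R : realType} (W : normedModType R) n (f : 'rV[R]_n -> W) q :
  differentiable f q -> (forall k, 'D_('e_k) f q = 0) -> forall v, 'D_v f q = 0.
Proof.
move=> df f0 v; rewrite derive_dirE// big1// => i _.
by rewrite f0 scaler0.
Qed.

Lemma smooth_col_mx {R : realType} (V : normedModType R) m1 m2 n (D : set V)
    (A : V -> 'M[R]_(m1, n)) (B : V -> 'M[R]_(m2, n)) : open D ->
  smooth_on D A -> smooth_on D B -> smooth_on D (fun q => col_mx (A q) (B q)).
Proof.
move=> oD sA sB; apply/smooth_mxP => // i j.
case: (splitP i) => k ik.
  rewrite (_ : (fun _ => _) = fun q => A q k j).
    exact: (smooth_mxP _ oD).1 sA k j.
  apply/funext => q; have -> : i = lshift m2 k by exact: val_inj.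
  by rewrite col_mxEu.
rewrite (_ : (fun _ => _) = fun q => B q k j).
  exact: (smooth_mxP _ oD).1 sB k j.
apply/funext => q; have -> : i = rshift m1 k by exact: val_inj.
by rewrite col_mxEd.
Qed.

Lemma derive_col_mx {R : realType} (V : normedModType R) m1 m2 n
    (A : V -> 'M[R]_(m1, n)) (B : V -> 'M[R]_(m2, n)) x v :
  differentiable A x -> differentiable B x ->
  'D_v (fun q => col_mx (A q) (B q)) x = col_mx ('D_v A x) ('D_v B x).
Proof.
move=> dA dB.
have eA i j : (fun q => col_mx (A q) (B q) (lshift m2 i) j) = (fun q => A q i j).
  by apply/funext => q; rewrite col_mxEu.
have eB i j : (fun q => col_mx (A q) (B q) (rshift m1 i) j) = (fun q => B q i j).
  by apply/funext => q; rewrite col_mxEd.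
have dAB : differentiable (fun q => col_mx (A q) (B q)) x.
  apply/differentiable_mxP => i j; case: (splitP i) => k ik.
    have -> : i = lshift m2 k by exact: val_inj.
    by rewrite eA; exact: (differentiable_mxP A x).1.
  have -> : i = rshift m1 k by exact: val_inj.
  by rewrite eB; exact: (differentiable_mxP B x).1.
apply/matrixP => i j; rewrite deriveE_mx//; case: (splitP i) => k ik.
  have -> : i = lshift m2 k by exact: val_inj.
  by rewrite eA col_mxEu deriveE_mx.
have -> : i = rshift m1 k by exact: val_inj.
by rewrite eB col_mxEd deriveE_mx.
Qed.

(** A family of subspaces whose derivative stays inside it does not move. *)
Lemma proj_row_constant {R : realType} k d n (D : set 'rV[R]_n)
    (F : 'rV[R]_n -> 'M[R]_(k, d)) : open D -> connected D -> smooth_on D F ->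
  (forall q, D q -> row_free (F q)) ->
  (forall q i, D q -> ('D_('e_i) F q <= F q)%MS) ->
  forall q q', D q -> D q' -> proj_row (F q) = proj_row (F q').
Proof.
move=> oD cD sF Ff DF; have sP := smooth_proj_row oD sF Ff.
apply: (derive0_connected_mx oD cD) => [x|x v] Dx.
  exact: smooth_differentiable sP Dx.
apply: derive0_dirs => [|i]; first exact: smooth_differentiable sP Dx.
apply: (derive_proj_row0 oD sF Ff Dx).
by apply: proj_row_sub; [exact: Ff|exact: DF].
Qed.

Section umbilic_surface.
Context {R : realType} {d : nat} (D : set 'rV[R]_2).
Context (z nu : 'rV[R]_2 -> 'rV[R]_d).
Context (rz : regular_patch D z) (unu : unit_normal (fun=> setT) D z nu).
Context (weingarten_nu : forall q, D q ->
  exists W, jacobian nu q = W *m jacobian z q).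
Context (umbilic : forall q (T : 'rV[R]_d), D q -> jacobian z q *m T^T = 0 ->
  nu q *m T^T = 0 -> exists l : R, forall i j,
  (row i ('D_('e_j) (jacobian z) q) *m T^T) 0 0 =
    l * (jacobian z q *m (jacobian z q)^T) i j).

Let oD : open D. Proof. by case: rz. Qed.
Let sz : smooth_on D z. Proof. by case: rz. Qed.
Let zf q : D q -> row_free (jacobian z q). Proof. by case: rz => _ _; exact. Qed.
Let snu : smooth_on D nu. Proof. by case: unu. Qed.
Let nunu q : D q -> dot (nu q) (nu q) = 1. Proof. by case: unu => _ H /H[]. Qed.
Let znu q : D q -> jacobian z q *m (nu q)^T = 0.
Proof. by case: unu => _ H /H[_ _]; exact: jacobian_normal0. Qed.

(* F spans the tangent plane and nu, Q projects onto the orthogonal complement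
   of F, and H is the mean curvature vector of the surface in the directions
   normal to nu: the umbilicity hypothesis says that the second derivatives of
   z have the components G i j H there. *)
Context (z1 : 'I_2 -> 'rV[R]_2 -> 'rV[R]_d).
Context (z2 : 'I_2 -> 'I_2 -> 'rV[R]_2 -> 'rV[R]_d).
Context (F : 'rV[R]_2 -> 'M[R]_(2 + 1, d)) (Q : 'rV[R]_2 -> 'M[R]_d).
Context (H : 'rV[R]_2 -> 'rV[R]_d).
Let G i j q := dot (z1 i q) (z1 j q).
Context (z1E : forall i, z1 i = 'D_('e_i) z).
Context (z2E : forall i j, z2 i j = 'D_('e_j) (z1 i)).
Context (FE : F = fun q => col_mx (jacobian z q) (nu q)).
Context (QE : Q = fun q => 1%:M - proj_row (F q)).
Context (HE : H = fun q => (G 0 0 q)^-1 *: (z2 0 0 q *m Q q)).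

Let row_z i q : D q -> row i (jacobian z q) = z1 i q.
Proof.
by move=> Dq; rewrite z1E; apply: row_jacobian; exact: smooth_differentiable Dq.
Qed.

Let row_z2 i j q : D q -> row i ('D_('e_j) (jacobian z) q) = z2 i j q.
Proof.
by move=> Dq; rewrite rowE z2E z1E; exact: derive_mul_jacobian oD sz Dq.
Qed.

Let GE i j q : D q -> (jacobian z q *m (jacobian z q)^T) i j = G i j q.
Proof. by move=> Dq; rewrite /G dotE -!row_z// mulmx_row_tr. Qed.

Let G0 q : D q -> G 0 0 q * G 1 1 q - G 0 1 q * G 1 0 q != 0.
Proof.
by move=> Dq; rewrite -!GE// -det22E -unitfE -unitmxE gram_unit; exact: zf.
Qed.

Let nf q : D q -> row_free (nu q).
Proof. by move=> Dq; apply: unit_row_free; exact: nunu. Qed.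

Let Ff q : D q -> row_free (F q).
Proof.
move=> Dq; rewrite FE.
by apply: row_free_orthogonal; [exact: zf|exact: nf|exact: znu].
Qed.

Let sZ : smooth_on D (jacobian z). Proof. exact: smooth_jacobian. Qed.
Let sF : smooth_on D F.
Proof.
by rewrite FE; exact: smooth_col_mx.
Qed.

Let sQ : smooth_on D Q.
Proof.
rewrite QE; have := smooth_opp oD (smooth_proj_row oD sF Ff).
by move/(smooth_add oD (smooth_cst D (1%:M : 'M[R]_d))).
Qed.

Let FQ q : D q -> F q *m Q q = 0.
Proof.
by move=> Dq; rewrite QE mulmxBr mulmx1 mul_proj_row ?subrr//; exact: Ff.
Qed.

Let ZQ q : D q -> jacobian z q *m Q q = 0.
Proof.
move=> Dq; have := FQ Dq; rewrite FE mul_col_mx => e.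
by apply/matrixP => i j; have /matrixP/(_ (lshift 1 i) j) := e;
  rewrite col_mxEu => ->; rewrite !mxE.
Qed.

Let z1Q i q : D q -> z1 i q *m Q q = 0.
Proof. by move=> Dq; rewrite -row_z// -row_mul ZQ// row0. Qed.

Let nuQ q : D q -> nu q *m Q q = 0.
Proof.
move=> Dq; have := FQ Dq; rewrite FE mul_col_mx => e.
by apply/matrixP => i j; have /matrixP/(_ (rshift 2 i) j) := e;
  rewrite col_mxEd => ->; rewrite !mxE.
Qed.

Let QT q : (Q q)^T = Q q.
Proof. by rewrite QE linearB /= trmx1 proj_row_tr. Qed.

Let QQ q : D q -> Q q *m Q q = Q q.
Proof.
move=> Dq; rewrite {2}QE mulmxBr mulmx1 (_ : Q q *m proj_row _ = 0) ?subr0//.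
by rewrite QE mulmxBl mul1mx proj_row_idem ?subrr//; exact: Ff.
Qed.

Let HQ q : D q -> H q *m Q q = H q.
Proof. by move=> Dq; rewrite HE -scalemxAl -mulmxA QQ. Qed.

Let z1_neq0 i q : D q -> z1 i q != 0.
Proof.
move=> Dq; rewrite -row_z// rowE -(mul0mx _ (jacobian z q)).
rewrite (inj_eq (row_free_inj (zf Dq))); apply/eqP => /matrixP/(_ 0 i).
by rewrite !mxE !eqxx => /eqP; rewrite oner_eq0.
Qed.

Let G00 q : D q -> G 0 0 q != 0.
Proof.
by move=> Dq; apply/eqP => /dot_self_eq0 e; move: (z1_neq0 0 Dq); rewrite e eqxx.
Qed.

Let z2Q i j q : D q -> z2 i j q *m Q q = G i j q *: H q.
Proof.
move=> Dq; apply/eqP; rewrite -subr_eq0; apply/eqP/dot_self_eq0.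
set w := _ - _.
(* umbilicity in the normal direction w makes w orthogonal to itself *)
have [l lE] : exists l, forall i j, dot (z2 i j q *m Q q) w = l * G i j q.
  have [||l lE] := @umbilic q (w *m Q q) Dq.
  - by rewrite trmx_mul QT mulmxA ZQ// mul0mx.
  - by rewrite trmx_mul QT mulmxA nuQ// mul0mx.
  exists l => a b; rewrite -GE// -lE row_z2// trmx_mul QT mulmxA.
  by rewrite dotE.
have wE : w = z2 i j q *m Q q - (G i j q / G 0 0 q) *: (z2 0 0 q *m Q q).
  by rewrite /w HE scalerA.
clearbody w; rewrite {1}wE -scaleNr dotDl dotZl !lE.
by have := G00 Dq; move: (G _ _ q) (G _ _ q) => a b b0; field.
Qed.

Let sz1 i : smooth_on D (z1 i). Proof. by rewrite z1E; exact: smooth_derive. Qed.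
Let sz2 i j : smooth_on D (z2 i j).
Proof. by rewrite z2E; exact: smooth_derive. Qed.

Let sG i j : smooth_on D (G i j).
Proof.
apply: (smooth_eq oD _ ((smooth_mxP _ oD).1
  (smooth_mulmx oD sZ (smooth_trmx oD sZ)) i j)) => q Dq.
exact: GE.
Qed.

Let sH : smooth_on D H.
Proof.
rewrite HE; apply: smooth_scale => //; last first.
  by apply: smooth_mulmx => //; exact: sz2.
by apply: smooth_inv.
Qed.

Let Hz i q : D q -> dot (H q) (z1 i q) = 0.
Proof.
move=> Dq; rewrite -HQ//; apply/dot_eq0.
by rewrite -mulmxA -[Q q]QT -trmx_mul z1Q// trmx0 mulmx0.
Qed.

Let Hnu q : D q -> dot (H q) (nu q) = 0.
Proof.
move=> Dq; rewrite -HQ//; apply/dot_eq0.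
by rewrite -mulmxA -[Q q]QT -trmx_mul nuQ// trmx0 mulmx0.
Qed.

Let nuz i q : D q -> dot (nu q) (z1 i q) = 0.
Proof.
move=> Dq; apply/dot_eq0; rewrite -row_z// -[LHS]trmxK trmx_mul trmxK.
by rewrite -row_mul znu// row0 trmx0.
Qed.

Let nu'Q k q : D q -> 'D_('e_k) nu q *m Q q = 0.
Proof.
move=> Dq; have [W WE] := weingarten_nu Dq.
rewrite -row_jacobian; last exact: smooth_differentiable snu Dq.
by rewrite WE -row_mul -mulmxA ZQ// mulmx0 row0.
Qed.

Let dec i j q : D q -> exists c0 c1 h, z2 i j q
  = c0 *: z1 0 q + c1 *: z1 1 q + h *: nu q + G i j q *: H q.
Proof.
move=> Dq; pose C := z2 i j q *m ((F q)^T *m invmx (F q *m (F q)^T)).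
have zE : z2 i j q = C *m F q + G i j q *: H q.
  rewrite -z2Q// QE mulmxBr mulmx1 /C /proj_row -!mulmxA addrC subrK.
  by [].
have [c1 [h cE]] : exists (c : 'rV_2) (h : 'rV_1), C = row_mx c h.
  by exists (lsubmx C), (rsubmx C); rewrite hsubmxK.
exists (c1 0 0), (c1 0 1), (h 0 0); rewrite zE cE FE mul_row_col; congr (_ + _).
congr (_ + _); last by rewrite {1}[h]mx11_scalar mul_scalar_mx.
rewrite -!row_z//; move: (jacobian z q) => Z.
apply/rowP => k; rewrite !mxE !big_ord_recl big_ord0 addr0.
by congr (_ + c1 _ _ * Z _ _); apply: val_inj.
Qed.

Let diffD (V : normedModType R) (f : 'rV[R]_2 -> V) q :
  smooth_on D f -> D q -> differentiable f q.
Proof. exact: smooth_differentiable. Qed.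

Let HQ' k q : D q -> 'D_('e_k) H q *m Q q = 0.
Proof.
move=> Dq; move: k.
apply: (@mean_curvature_parallel _ _ _ D q (fun k => 'e_k) z1 z2 nu H Q) => //.
- by move=> i; exact: diffD (sz1 i) Dq.
- by move=> i j; exact: diffD (sz2 i j) Dq.
- exact: diffD snu Dq.
- exact: diffD sH Dq.
- exact: diffD sQ Dq.
- by move=> i k; rewrite z2E.
- move=> i j k; rewrite !z2E.
  exact: derive_derive_sym_mx oD (sz1 i) Dq.
- move=> i j; rewrite !z2E !z1E; exact: derive_derive_sym_mx oD sz Dq.
- by move=> k; exact: nu'Q.
- by move=> i j; exact: dec.
- by move=> i; exact: nuz.
- by move=> i; exact: Hz.
exact: G0.
Qed.

Let dot_HQ q (v : 'rV[R]_d) : D q -> dot (H q) v = dot (H q) (v *m Q q).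
Proof. by move=> Dq; rewrite !dotE trmx_mul QT mulmxA HQ. Qed.

Let kappa q := dot (H q) (H q).

(** H is parallel in the normal bundle: its derivative has no component along
    Q, by HQ', nor along nu, whose derivative is tangent; the tangential
    component follows from <H, z1> = 0. *)
Let H'E k q : D q -> 'D_('e_k) H q = - (kappa q *: z1 k q).
Proof.
move=> Dq; apply/eqP; rewrite -addr_eq0; apply/eqP.
have dH := diffD sH Dq; have dnu := diffD snu Dq.
have dz1 i := diffD (sz1 i) Dq.
have H'z i : dot ('D_('e_k) H q) (z1 i q) = - (kappa q * G i k q).
  have E := etrans (esym (derive_dot 'e_k dH (dz1 i)))
    (derive_eq_on 'e_k oD Dq (Hz i)).
  rewrite derive_cst in E; move/eqP: E; rewrite addr_eq0 => /eqP ->.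
  have -> : 'D_('e_k) (z1 i) q = z2 i k q by rewrite z2E.
  by rewrite dot_HQ// z2Q// dotC dotZl mulrC.
have H'nu : dot ('D_('e_k) H q) (nu q) = 0.
  have E := etrans (esym (derive_dot 'e_k dH dnu)) (derive_eq_on 'e_k oD Dq Hnu).
  by rewrite derive_cst dot_HQ// nu'Q// [dot (H q) 0]dotC dot0l addr0 in E.
have : ('D_('e_k) H q + kappa q *: z1 k q) *m Q q = 0.
  by rewrite mulmxDl HQ'// -scalemxAl z1Q// scaler0 addr0.
move: H'z H'nu; move: ('D_('e_k) H q) => H' H'z H'nu.
rewrite QE mulmxBr mulmx1 mul_proj_row_eq0 ?subr0// FE tr_col_mx mul_mx_row.
rewrite -[RHS]row_mx0; congr row_mx.
  apply/rowP => i; rewrite [RHS]mxE -mulmx_row_tr row_id row_z// -dotE.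
  by rewrite dotDl dotZl H'z [dot _ _]dotC /G addNr.
by apply/dot_eq0; rewrite dotDl H'nu dotZl dotC nuz// mulr0 addr0.
Qed.

Let kappa_const q q' : connected D -> D q -> D q' -> kappa q = kappa q'.
Proof.
move=> cD Dq Dq'; apply: (derive0_connected oD cD _ _ Dq Dq') => [x|x v] Dx.
  by have dH := diffD sH Dx; exact: differentiable_dot.
have dH := diffD sH Dx; apply: derive0_dirs; first exact: differentiable_dot.
move=> k; apply: (etrans (derive_dot 'e_k dH dH)).
rewrite H'E// -scaleNr [dot (H x) _]dotC dotZl dotC Hz// mulr0 addr0.
by [].
Qed.

Let z1_sub i q : D q -> (z1 i q <= F q)%MS.
Proof.
by move=> Dq; rewrite -row_z// FE -[row i _]mul1mx -addsmxE;
   apply: submx_trans (addsmxSl _ _); rewrite mul1mx row_sub.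
Qed.

Let nu_sub q : (nu q <= F q)%MS.
Proof. by rewrite FE -addsmxE addsmxSr. Qed.

Let nu'_sub k q : D q -> ('D_('e_k) nu q <= F q)%MS.
Proof.
move=> Dq; have [W WE] := weingarten_nu Dq.
rewrite -row_jacobian; last exact: diffD snu Dq.
rewrite WE row_mul FE -addsmxE; apply: submx_trans (addsmxSl _ _).
exact: submxMl.
Qed.

Let z2_sub i j q : D q -> (z2 i j q - G i j q *: H q <= F q)%MS.
Proof.
move=> Dq; apply: sub_proj_row; rewrite -z2Q// QE mulmxBr mulmx1 opprB.
by rewrite addrC subrK -mulmxA proj_row_idem//; exact: Ff.
Qed.

Let F'E k q : D q -> 'D_('e_k) F q =
  col_mx ('D_('e_k) (jacobian z) q) ('D_('e_k) nu q).
Proof.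
move=> Dq; rewrite FE; apply: derive_col_mx; first exact: diffD sZ Dq.
exact: diffD snu Dq.
Qed.

Let F'_sub m (M : 'M[R]_(m, d)) k q : D q -> (F q <= M)%MS -> (H q <= M)%MS ->
  ('D_('e_k) F q <= M)%MS.
Proof.
move=> Dq FM HM; rewrite F'E// col_mx_sub; apply/andP; split; last first.
  exact: submx_trans (nu'_sub k Dq) FM.
apply/row_subP => i; rewrite row_z2// -(subrK (G i k q *: H q) (z2 i k q)).
apply: addmx_sub; last exact: scalemx_sub.
exact: submx_trans (z2_sub i k Dq) FM.
Qed.

Context (cD : connected D).
Context (minimal : forall q, D q -> \tr (shape_op z nu q) = 0).

(** Without mean curvature vector, the span of the tangent plane and nu is
    constant, and so is the component of z orthogonal to it. *)
Lemma umbilic_surface_affine q0 : D q0 -> kappa q0 = 0 ->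
  minimal_in_affine3 (z q0) (F q0) D z nu.
Proof.
move=> Dq0 k0.
have H0 q : D q -> H q = 0.
  by move=> Dq; apply: dot_self_eq0; rewrite -k0; exact: kappa_const.
have DF q i : D q -> ('D_('e_i) F q <= F q)%MS.
  by move=> Dq; apply: F'_sub => //; rewrite H0// sub0mx.
have PE q : D q -> proj_row (F q) = proj_row (F q0).
  by move=> Dq; exact: (proj_row_constant oD cD sF Ff DF).
have sub0 p (v : 'M[R]_(p, d)) q : D q -> (v <= F q)%MS -> (v <= F q0)%MS.
  move=> Dq vF; apply: sub_proj_row; rewrite -(PE q Dq).
  by apply: proj_row_sub vF; exact: Ff.
split; first exact: Ff.
split=> //; last first.
  split=> // q Dq; split; [|exact: nunu|].
    exact: sub0 Dq (nu_sub q).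
  by have [_ /(_ q Dq)[]] := unu.
move=> q Dq; apply: sub_proj_row.
have cst : z q *m Q q0 = z q0 *m Q q0.
  have dzQ x : D x -> differentiable (fun y => z y *m Q q0) x.
    by move=> Dx; apply: differentiable_mulmx => //; exact: diffD sz Dx.
  apply: (derive0_connected_mx oD cD dzQ _ Dq Dq0) => x v Dx.
  apply: derive0_dirs; first exact: dzQ.
  move=> k; apply: (etrans (derive_mulmxr _ _ (diffD sz Dx))).
  have -> : 'D_('e_k) z x = z1 k x by rewrite z1E.
  by rewrite !QE -(PE x Dx); move: (z1Q k Dx); rewrite QE.
have : (z q - z q0) *m Q q0 = 0 by rewrite mulmxBl cst subrr.
by rewrite QE mulmxBr mulmx1 => /eqP; rewrite subr_eq0 => /eqP.
Qed.

(** The derivative of H being - |H|^2 times that of z, the point z + H / |H|^2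
    does not move; neither does the span of the tangent plane, nu and H. *)
Lemma umbilic_surface_sphere q0 : D q0 -> kappa q0 != 0 ->
  minimal_in_sphere3 (z q0 + (kappa q0)^-1 *: H q0) (col_mx (F q0) (H q0))
    (Num.sqrt (kappa q0)^-1) D z nu.
Proof.
move=> Dq0 k0.
have kE q : D q -> kappa q = kappa q0 by move=> Dq; exact: kappa_const.
have kp : 0 < kappa q0.
  rewrite lt_neqAle eq_sym k0 /=; apply: sumr_ge0 => i _.
  by rewrite -expr2 sqr_ge0.
pose F4 q := col_mx (F q) (H q).
have F4f q : D q -> row_free (F4 q).
  move=> Dq; apply: row_free_orthogonal; first exact: Ff.
    rewrite -gram_unit (_ : _ *m _ = (kappa q)%:M).
      by rewrite unitmxE det_scalar expr1 unitfE kE.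
    by apply/matrixP => i j; rewrite !ord1 -dotE !mxE.
  rewrite FE mul_col_mx; apply/eqP; rewrite -[0]col_mx0; apply/eqP.
  congr col_mx; last by apply/dot_eq0; rewrite dotC Hnu.
  apply/row_matrixP => i; rewrite row_mul row_z// row0; apply/dot_eq0.
  by rewrite dotC Hz.
have sF4 : smooth_on D F4 by exact: smooth_col_mx.
have DF4 q i : D q -> ('D_('e_i) F4 q <= F4 q)%MS.
  move=> Dq; have sub1 : (F q <= F4 q)%MS by rewrite /F4 -addsmxE addsmxSl.
  have sub2 : (H q <= F4 q)%MS by rewrite /F4 -addsmxE addsmxSr.
  have -> := derive_col_mx 'e_i (diffD sF Dq) (diffD sH Dq).
  rewrite col_mx_sub F'_sub//= H'E// -scaleNr scalemx_sub//.
  exact: submx_trans (z1_sub i Dq) sub1.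
have PE q : D q -> proj_row (F4 q) = proj_row (F4 q0).
  by move=> Dq; exact: (proj_row_constant oD cD sF4 F4f DF4).
have sub0 p (v : 'M[R]_(p, d)) q : D q -> (v <= F4 q)%MS -> (v <= F4 q0)%MS.
  move=> Dq vF; apply: sub_proj_row; rewrite -(PE q Dq).
  by apply: proj_row_sub vF; exact: F4f.
have center q : D q ->
    z q + (kappa q0)^-1 *: H q = z q0 + (kappa q0)^-1 *: H q0.
  move=> Dq; pose c y := z y + (kappa q0)^-1 *: H y.
  have dc x : D x -> differentiable c x.
    move=> Dx; apply: differentiableD; first exact: diffD sz Dx.
    by apply: differentiableZ; exact: diffD sH Dx.
  apply: (derive0_connected_mx oD cD dc _ Dq Dq0) => x v Dx.
  apply: derive0_dirs; first exact: dc.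
  move=> k; have dzk : derivable z x 'e_k by exact/diff_derivable/diffD.
  have dHk : derivable H x 'e_k by exact/diff_derivable/diffD.
  have dkH : derivable ((kappa q0)^-1 *: H) x 'e_k by exact: derivableZ.
  apply: (etrans (deriveD dzk dkH)).
  have -> : 'D_('e_k) z x = z1 k x by rewrite z1E.
  rewrite (deriveZ _ dHk) H'E// kE// scalerN scalerA mulVf// scale1r.
  by rewrite subrr.
have zc q : D q -> z q - (z q0 + (kappa q0)^-1 *: H q0) = - (kappa q0)^-1 *: H q.
  by move=> Dq; rewrite -(center q Dq) opprD addNKr scaleNr.
split; [exact: F4f|by rewrite sqrtr_gt0 invr_gt0|].
split=> //; last first.
  split=> // q Dq; split; [|exact: nunu|by have [_ /(_ q Dq)[]] := unu].
  split; last by rewrite zc// dotC dotZl Hnu// mulr0.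
  by apply: (sub0 _ _ q) => //; rewrite /F4 -addsmxE;
    exact: submx_trans (nu_sub q) (addsmxSl _ _).
move=> q Dq; split; rewrite /affine_space/= zc//.
  rewrite scalemx_sub//; apply: (sub0 _ _ q) => //.
  by rewrite /F4 -addsmxE addsmxSr.
rewrite dotZl dotC dotZl -/(kappa q) kE// sqr_sqrtr ?invr_ge0 ?ltW//.
by rewrite mulrA mulrNN -mulrA mulVf// mulr1.
Qed.

End umbilic_surface.

Lemma umbilic_surface_space_form {R : realType} d (D : set 'rV[R]_2)
    (z nu : 'rV[R]_2 -> 'rV[R]_d) : (3 <= d)%N ->
  connected D -> regular_patch D z -> unit_normal (fun=> setT) D z nu ->
  (forall q, D q -> exists W, jacobian nu q = W *m jacobian z q) ->
  (forall q (T : 'rV[R]_d), D q -> jacobian z q *m T^T = 0 ->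
    nu q *m T^T = 0 -> exists l : R, forall i j,
    (row i ('D_('e_j) (jacobian z) q) *m T^T) 0 0 =
      l * (jacobian z q *m (jacobian z q)^T) i j) ->
  (forall q, D q -> \tr (shape_op z nu q) = 0) ->
  (exists c (E : 'M[R]_(3, d)), minimal_in_affine3 c E D z nu) \/
  (exists c (E : 'M[R]_(4, d)) r, minimal_in_sphere3 c E r D z nu).
Proof.
move=> d3 cD rz unu wnu umb tr0.
have [[q0 Dq0]|D0] := pselect (exists q, D q); last first.
  have noD q : ~ D q by move=> Dq; apply: D0; exists q.
  (* over an empty domain any affine 3-space will do *)
  left; exists 0, (pid_mx 3); split; first by rewrite /row_free rank_pid_mx.
  split=> //; first by move=> q /noD.
  by case: unu => snu _; split=> // q /noD.
pose z1 i := 'D_('e_i) z; pose z2 (i j : 'I_2) := 'D_('e_j) (z1 i).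
pose F q := col_mx (jacobian z q) (nu q).
pose Q q : 'M[R]_d := 1%:M - proj_row (F q).
pose H q := (dot (z1 0 q) (z1 0 q))^-1 *: (z2 0 0 q *m Q q).
have [k0|k0] := eqVneq (dot (H q0) (H q0)) 0.
  left; exists (z q0), (F q0).
  exact: (@umbilic_surface_affine _ _ D z nu rz unu wnu umb z1 z2 F Q H
    (fun=> erefl) (fun _ _ => erefl) erefl erefl erefl cD tr0 q0 Dq0 k0).
right; do 3!eexists.
exact: (@umbilic_surface_sphere _ _ D z nu rz unu wnu umb z1 z2 F Q H
    (fun=> erefl) (fun _ _ => erefl) erefl erefl erefl cD tr0 q0 Dq0 k0).
Qed.

Lemma integral_surface_space_form {R : realType} n (U : set 'rV[R]_n)
    (X N : 'rV[R]_n -> 'rV[R]_n.+1) (D : set 'rV[R]_2)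
    (phi : 'rV[R]_2 -> 'rV[R]_n) : (3 <= n)%N ->
  type_number_two U X N -> minimal_type_two U X N -> connected D ->
  integral_surface U X N D phi ->
  (exists c (E : 'M[R]_(3, n.+1)), minimal_in_affine3 c E D (X \o phi) (N \o phi)) \/
  (exists c (E : 'M[R]_(4, n.+1)) r,
     minimal_in_sphere3 c E r D (X \o phi) (N \o phi)).
Proof.
move=> n3 tX mX cD iphi; have [rX uN _] := tX.
apply: (umbilic_surface_space_form (leqW n3) cD).
- exact: (integral_surface_patch rX iphi).
- exact: (integral_surface_normal rX uN iphi).
- move=> q Dq; have [K [SE _]] := integral_surface_factor rX iphi Dq.
  exists (- (jacobian phi q *m K)).
  by rewrite (integral_surface_weingarten rX uN iphi Dq SE) mulNmx.
- by move=> q T Dq; exact: (integral_surface_umbilic rX uN iphi n3 tX mX Dq).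
by move=> q Dq; exact: (integral_surface_minimal rX uN iphi n3 tX mX Dq).
Qed.

(** * Hypersurfaces generated by a surface *)

Section linear_coordinates.
Context {R : realType}.

Lemma smooth_coord m n (U : set 'M[R]_(m, n)) i j : open U ->
  smooth_on U (fun M : 'M[R]_(m, n) => M i j).
Proof.
move=> oU [|k]; first by move=> x _; exact: coord_continuous.
split=> [x _|v]; first exact: differentiable_coord.
apply: (Ck_eq oU _ (Ck_cst k U (v i j))) => x _.
rewrite -[RHS](deriveE_mx (F := id))//.
by rewrite derive_id.
Qed.

Lemma smooth_lsubmx m n (U : set 'rV[R]_(m + n)) : open U ->
  smooth_on U (lsubmx : 'rV[R]_(m + n) -> 'rV[R]_m).
Proof.
move=> oU; apply/smooth_mxP => // i j.
by apply: (smooth_eq oU _ (smooth_coord i (lshift n j) oU)) => x _; rewrite mxE.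
Qed.

Lemma derive_lsubmx m n (x v : 'rV[R]_(m + n)) :
  'D_v (lsubmx : 'rV[R]_(m + n) -> 'rV[R]_m) x = lsubmx v.
Proof.
have dl : differentiable (lsubmx : 'rV[R]_(m + n) -> 'rV[R]_m) x.
  exact: differentiable_lsubmx.
apply/matrixP => i j; rewrite deriveE_mx// [RHS]mxE.
rewrite (_ : (fun _ => _) = fun y : 'rV[R]_(m + n) => y i (lshift n j)).
  by rewrite -(deriveE_mx (F := id))// derive_id.
by apply/funext => y; rewrite mxE.
Qed.

Lemma derive_comp_lsubmx m n (W : normedModType R) (f : 'rV[R]_m -> W)
    (p v : 'rV[R]_(m + n)) : differentiable f (lsubmx p) ->
  'D_v (fun p : 'rV[R]_(m + n) => f (lsubmx p)) p = 'D_(lsubmx v) f (lsubmx p).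
Proof.
move=> df; rewrite -(derive_lsubmx p v).
by apply: (@derive_comp _ _ _ _ f lsubmx p v) => //; exact: differentiable_lsubmx.
Qed.

Lemma open_lsubmx m n (D : set 'rV[R]_m) : open D ->
  open [set p : 'rV[R]_(m + n) | D (lsubmx p)].
Proof.
move=> oD; have cl : {in lsubmx @^-1` D,
    continuous (lsubmx : 'rV[R]_(m + n) -> 'rV[R]_m)}.
  by move=> p _; exact/differentiable_continuous/differentiable_lsubmx.
exact: open_comp cl oD.
Qed.

Lemma open_neq0 (V : normedModType R) (U : set V) (f : V -> R) : open U ->
  (forall x, U x -> {for x, continuous f}) -> open [set x | U x /\ f x != 0].
Proof.
move=> oU cf; rewrite openE => x [Ux fx].
have n1 : nbhs x U by exact: open_nbhs_nbhs.
have n2 : nbhs x [set y | f y != 0].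
  have cfx : f @ x --> f x by exact: cf.
  have nf : nbhs (f x) [set t | t != 0].
    by apply: open_nbhs_nbhs; split; [exact: open_neq|].
  exact: cfx nf.
have n12 : nbhs x (U `&` [set y | f y != 0]) by apply: filterI.
by apply: filterS n12 => y [].
Qed.

Lemma trace_gram_gt0 m n (C : 'M[R]_(m, n)) : C != 0 -> 0 < \tr (C *m C^T).
Proof.
move=> C0; rewrite lt_neqAle; apply/andP; split; last first.
  apply: sumr_ge0 => i _; rewrite mxE; apply: sumr_ge0 => j _.
  by rewrite mxE -expr2 sqr_ge0.
apply: contraNN C0; rewrite eq_sym psumr_eq0; last first.
  move=> i _; rewrite mxE; apply: sumr_ge0 => j _.
  by rewrite mxE -expr2 sqr_ge0.
move=> /allP H; apply/eqP/row_matrixP => i; rewrite row0.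
have := H i (mem_index_enum _); rewrite /= => /eqP Hi; apply: dot_self_eq0.
by rewrite dotE mulmx_row_tr.
Qed.

(** s^2 = - det s, while s^2 (Z Z^T) is the Gram matrix of s Z, which is
    nonzero; compare the traces. *)
Lemma traceless_det_lt0 d (Z : 'M[R]_(2, d)) (h : 'M[R]_2) :
  let s := h *m invmx (Z *m Z^T) in
  row_free Z -> h^T = h -> h != 0 -> \tr s = 0 -> \det s < 0.
Proof.
move=> s Zf hT h0 trs; have Gu : Z *m Z^T \in unitmx by rewrite gram_unit.
have hE : h = s *m (Z *m Z^T) by rewrite /s mulmxKV.
clearbody s.
have hE' : h = (Z *m Z^T) *m s^T by rewrite -hT hE trmx_mul trmx_gram.
pose C := s *m Z.
have C0 : C != 0.
  by apply: contraNN h0 => /eqP C0; rewrite hE mulmxA -/C C0 mul0mx.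
have CC : C *m C^T = - \det s *: (Z *m Z^T).
  rewrite /C trmx_mul mulmxA -(mulmxA s) -hE.
  have -> : h *m s^T = s *m h by rewrite [in LHS]hE -mulmxA -hE'.
  by rewrite hE mulmxA traceless_sqr// mul_scalar_mx.
have Z0 : Z != 0.
  by apply: contraNN C0 => /eqP Z0; rewrite /C Z0 mulmx0.
have := trace_gram_gt0 C0; rewrite CC mxtraceZ.
by rewrite pmulr_lgt0 ?oppr_gt0//; exact: trace_gram_gt0.
Qed.

Lemma char_poly_traceless (s : 'M[R]_2) : \tr s = 0 -> \det s < 0 ->
  let r := Num.sqrt (- \det s) in
  char_poly s = ('X - r%:P) * ('X - (- r)%:P).
Proof.
move=> trs ds r.
have rr : r * r = - \det s by rewrite -expr2 sqr_sqrtr// oppr_ge0 ltW.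
rewrite /char_poly det22E !mxE /= mulr1n mulr0n.
have := trs; rewrite mxtrace22E => /eqP; rewrite addr_eq0 => /eqP s00.
have rrE : r%:P * r%:P = (s 1 1 * s 1 1 + s 0 1 * s 1 0)%:P :> {poly R}.
  by rewrite -polyCM rr det22E s00; congr (_%:P); ring.
have -> : ('X - r%:P) * ('X - (- r)%:P) = 'X * 'X - r%:P * r%:P :> {poly R}.
  by rewrite polyCN; ring.
by rewrite rrE s00 !sub0r !polyCN polyCD !polyCM; ring.
Qed.

End linear_coordinates.

Lemma char_poly_block0 {R : comNzRingType} m n (A : 'M[R]_m) (C : 'M[R]_(m, n)) :
  char_poly (block_mx A C 0 0 : 'M[R]_(m + n)) = char_poly A * 'X^n.
Proof.
rewrite /char_poly /char_poly_mx map_block_mx scalar_mx_block opp_block_mx.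
by rewrite add_block_mx !map_mx0 !oppr0 !addr0 det_ublock det_scalar.
Qed.

Lemma derive_mulmx3_tr {R : realType} (V : normedModType R) m n p r
    (F : V -> 'M[R]_(m, n)) (G : V -> 'M[R]_(n, p)) (H : V -> 'M[R]_(r, p)) x v :
  differentiable F x -> differentiable G x -> differentiable H x ->
  'D_v (fun y => F y *m G y *m (H y)^T) x
    = ('D_v F x *m G x + F x *m 'D_v G x) *m (H x)^T
      + F x *m G x *m ('D_v H x)^T.
Proof.
move=> dF dG dH; have dFG := differentiable_mulmx dF dG.
by apply: (etrans (derive_mulmx_tr v dFG dH)); rewrite derive_mulmx.
Qed.

Section generated_hypersurface.
Context {R : realType} {k d : nat} (D : set 'rV[R]_2).
Context (z N : 'rV[R]_2 -> 'rV[R]_d) (b : 'I_k -> 'rV[R]_2 -> 'rV[R]_d).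
Context (rz : regular_patch D z) (uN : unit_normal (fun=> setT) D z N).
Context (minimal : forall q, D q -> \tr (shape_op z N q) = 0).
Context (second_neq0 : forall q, D q -> second_ff z N q != 0).
Context (weingarten_N : forall q, D q ->
  exists W, jacobian N q = W *m jacobian z q).
Context (sb : forall a, smooth_on D (b a)).
Context (bc : forall q, D q ->
  orthogonal_complement_basis (b^~ q) (col_mx (jacobian z q) (N q))).
Context (umbilic : forall q a, D q -> exists t : R, forall i j,
  dot ('D_('e_j) ('D_('e_i) z) q) (b a q)
    = t * (jacobian z q *m (jacobian z q)^T) i j).

Let oD : open D. Proof. by case: rz. Qed.
Let sz : smooth_on D z. Proof. by case: rz. Qed.
Let zf q : D q -> row_free (jacobian z q). Proof. by case: rz => _ _; exact. Qed.
Let sN : smooth_on D N. Proof. by case: uN. Qed.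
Let NN q : D q -> dot (N q) (N q) = 1. Proof. by case: uN => _ H /H[]. Qed.
Let zN q : D q -> jacobian z q *m (N q)^T = 0.
Proof. by case: uN => _ H /H[_ _]; exact: jacobian_normal0. Qed.

Let B q := \matrix_(a < k) b a q.

Let Bf q : D q -> row_free (B q). Proof. by move=> /bc[]. Qed.

Let B_sub m (v : 'M[R]_(m, d)) q : D q ->
  (v <= B q)%MS <-> v *m (jacobian z q)^T = 0 /\ v *m (N q)^T = 0.
Proof.
move=> Dq; have [_ bcq] := bc Dq; split=> [vB|[vZ vN]].
  have : v *m (col_mx (jacobian z q) (N q))^T = 0.
    apply/matrixP => i j; rewrite mulmx_tr_dot [RHS]mxE.
    by apply: (bcq (row i v)).1; apply: submx_trans vB; exact: row_sub.
  by rewrite tr_col_mx mul_mx_row -row_mx0 => /eq_row_mx.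
apply/row_subP => i; apply/bcq => j; rewrite -mulmx_tr_dot.
by rewrite tr_col_mx mul_mx_row vZ vN row_mx0 mxE.
Qed.

Let BZ q : D q -> B q *m (jacobian z q)^T = 0.
Proof. by move=> Dq; have [] := (B_sub (B q) Dq).1 (submx_refl _). Qed.

Let BN q : D q -> B q *m (N q)^T = 0.
Proof. by move=> Dq; have [] := (B_sub (B q) Dq).1 (submx_refl _). Qed.

Let row_B a q : row a (B q) = b a q. Proof. exact: rowK. Qed.

Let bZ a q : D q -> b a q *m (jacobian z q)^T = 0.
Proof. by move=> Dq; rewrite -row_B -row_mul BZ// row0. Qed.

Let bN a q : D q -> b a q *m (N q)^T = 0.
Proof. by move=> Dq; rewrite -row_B -row_mul BN// row0. Qed.

Let G q := jacobian z q *m (jacobian z q)^T.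
Let GT q : (G q)^T = G q. Proof. exact: trmx_gram. Qed.

Let diffD (V : normedModType R) (f : 'rV[R]_2 -> V) q :
  smooth_on D f -> D q -> differentiable f q.
Proof. exact: smooth_differentiable. Qed.

Let sZ : smooth_on D (jacobian z). Proof. exact: smooth_jacobian. Qed.

Let jb_N a q : D q -> jacobian (b a) q *m (N q)^T = 0.
Proof.
move=> Dq; have db := diffD (sb a) Dq; have dN := diffD sN Dq.
apply/row_matrixP => i; rewrite row0 row_mul row_jacobian//.
have E := etrans (esym (derive_mulmx_tr 'e_i db dN))
  (derive_eq_on 'e_i oD Dq (bN a)).
have Ni : b a q *m ('D_('e_i) N q)^T = 0.
  have [W WE] := weingarten_N Dq; rewrite -row_jacobian// WE row_mul.
  by rewrite trmx_mul mulmxA bZ// mul0mx.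
by rewrite Ni addr0 derive_cst in E.
Qed.

Let jb_Z a q : D q -> exists t, jacobian (b a) q *m (jacobian z q)^T = t *: G q.
Proof.
move=> Dq; have db := diffD (sb a) Dq; have dZ := diffD sZ Dq.
have [t tE] := umbilic a Dq; exists (- t).
apply/matrixP => i j; rewrite mulmx_tr_dot [RHS]mxE row_jacobian//.
have E := etrans (esym (derive_mulmx_tr 'e_i db dZ))
  (derive_eq_on 'e_i oD Dq (bZ a)).
have {}E := congr1 (fun C : 'M[R]_(1, 2) => C 0 j) E.
rewrite derive_cst /= mxE !mulmx_tr_dot !row_id [RHS]mxE in E.
move/eqP: E; rewrite addr_eq0 => /eqP ->; rewrite mulNr; congr (- _).
have -> : G q i j = G q j i by rewrite -[in LHS]GT mxE.
rewrite -tE dotC.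
have -> // : row j ('D_('e_i) (jacobian z) q) = 'D_('e_i) ('D_('e_j) z) q.
by rewrite rowE; exact: derive_mul_jacobian oD sz Dq.
Qed.

Notation X := (generated z b).
Let U0 := [set p : 'rV[R]_(2 + k) | D (lsubmx p)].
Let oU0 : open U0. Proof. exact: open_lsubmx. Qed.

Let smooth_lift p' q' (f : 'rV[R]_2 -> 'M[R]_(p', q')) : smooth_on D f ->
  smooth_on U0 (fun p : 'rV[R]_(2 + k) => f (lsubmx p)).
Proof. by move=> sf; exact: (smooth_comp oU0 oD _ (smooth_lsubmx oU0) sf). Qed.

Let smooth_w (a : 'I_k) : smooth_on U0 (fun p : 'rV[R]_(2 + k) => rsubmx p 0 a).
Proof.
by apply: (smooth_eq oU0 _ (smooth_coord 0 (rshift 2 a) oU0)) => p _; rewrite mxE.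
Qed.

Let sX : smooth_on U0 X.
Proof.
apply: smooth_add => //; first exact: smooth_lift.
apply: smooth_sum => // a; apply: smooth_scale => //; exact: smooth_lift.
Qed.

Let A p := jacobian z (lsubmx p)
  + \sum_(a < k) rsubmx p 0 a *: jacobian (b a) (lsubmx p).

Let derive_lift p' q' (f : 'rV[R]_2 -> 'M[R]_(p', q')) p v : smooth_on D f ->
  U0 p -> 'D_v (fun p : 'rV[R]_(2 + k) => f (lsubmx p)) p
    = 'D_(lsubmx v) f (lsubmx p).
Proof. by move=> sf Dp; apply: derive_comp_lsubmx; exact: diffD sf Dp. Qed.

Let derive_w (a : 'I_k) (p v : 'rV[R]_(2 + k)) :
  'D_v (fun p : 'rV[R]_(2 + k) => rsubmx p 0 a) p = rsubmx v 0 a.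
Proof.
rewrite (_ : (fun _ => _) = fun p : 'rV[R]_(2 + k) => p 0 (rshift 2 a)).
  by rewrite -(deriveE_mx (F := id))// derive_id mxE.
by apply/funext => y; rewrite mxE.
Qed.

Let derive_X p v : U0 p ->
  'D_v X p = lsubmx v *m A p + rsubmx v *m B (lsubmx p).
Proof.
move=> Up; pose f (p : 'rV[R]_(2 + k)) := z (lsubmx p).
pose g a (p : 'rV[R]_(2 + k)) := rsubmx p 0 a *: b a (lsubmx p).
have dw a : differentiable (fun p : 'rV[R]_(2 + k) => rsubmx p 0 a) p.
  exact: smooth_differentiable (smooth_w a) Up.
have dbl a : differentiable (fun p : 'rV[R]_(2 + k) => b a (lsubmx p)) p.
  exact: smooth_differentiable (smooth_lift (sb a)) Up.
have dg a : derivable (g a) p v.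
  apply: diff_derivable; apply/differentiable_mxP => i j.
  rewrite (_ : (fun _ => _) = (fun p : 'rV[R]_(2 + k) => rsubmx p 0 a)
     * (fun p => b a (lsubmx p) i j)); last by apply/funext => y; rewrite mxE.
  by apply: differentiableM => //; exact: (differentiable_mxP _ p).1 (dbl a) i j.
have df : derivable f p v.
  by apply: diff_derivable; exact: smooth_differentiable (smooth_lift sz) Up.
have -> : X = f + \sum_a g a by apply/funext => y; rewrite fct_sumE.
have e1 : 'D_v f p = lsubmx v *m jacobian z (lsubmx p).
  rewrite (derive_lift v sz Up) deriveEjacobian//; exact: diffD sz Up.
have e2 a : 'D_v (g a) p = rsubmx p 0 a *: (lsubmx v *m jacobian (b a) (lsubmx p))
     + rsubmx v 0 a *: b a (lsubmx p).
  apply: (etrans (derive_scalemx v (dw a) (dbl a))).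
  rewrite derive_w (derive_lift v (sb a) Up) addrC deriveEjacobian//.
  exact: diffD (sb a) Up.
have dsum : derivable (\sum_a g a) p v by apply: derivable_sum.
apply: (etrans (deriveD df dsum)); apply: (etrans (congr1 (+%R _) (derive_sum dg))).
rewrite e1 (eq_bigr _ (fun a _ => e2 a)) /A mulmxDr -addrA; congr (_ + _).
rewrite mulmx_sumr big_split /=; congr (_ + _).
  by apply: eq_bigr => a _; rewrite scalemxAr.
by rewrite mulmx_sum_row; apply: eq_bigr => a _; rewrite row_B.
Qed.

Let jacX p : U0 p -> jacobian X p = col_mx (A p) (B (lsubmx p)).
Proof.
move=> Up; apply/row_matrixP => i; rewrite row_jacobian; last first.
  exact: smooth_differentiable sX Up.
by rewrite derive_X// rowE -mul_row_col hsubmxK.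
Qed.

Let AN p : U0 p -> A p *m (N (lsubmx p))^T = 0.
Proof.
move=> Up; rewrite /A mulmxDl zN// add0r mulmx_suml big1// => a _.
by rewrite -scalemxAl jb_N// scaler0.
Qed.

Let XN p : U0 p -> jacobian X p *m (N (lsubmx p))^T = 0.
Proof. by move=> Up; rewrite jacX// mul_col_mx AN// BN// col_mx0. Qed.

(** Modulo the rulings, the differential of X along the surface is a multiple
    mu of that of z: the rulings are normal directions in which the surface is
    umbilic. *)
Let A_decomposition p : U0 p -> exists (mu : R) (beta : 'M[R]_(2, k)),
  A p = mu *: jacobian z (lsubmx p) + beta *m B (lsubmx p).
Proof.
move=> Up; have [mu AZ] : exists mu : R,
    A p *m (jacobian z (lsubmx p))^T = mu *: G (lsubmx p).
  have /fin_all_exists[t tE] : forall a, exists t : R,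
    jacobian (b a) (lsubmx p) *m (jacobian z (lsubmx p))^T = t *: G (lsubmx p).
    by move=> a; exact: jb_Z.
  exists (1 + \sum_a rsubmx p 0 a * t a).
  rewrite /A mulmxDl scalerDl scale1r; congr (_ + _).
  rewrite mulmx_suml scaler_suml; apply: eq_bigr => a _.
  by rewrite -scalemxAl tE scalerA.
exists mu; have /submxP[beta E] :
    (A p - mu *: jacobian z (lsubmx p) <= B (lsubmx p))%MS.
  apply/(B_sub _ Up); rewrite !mulmxBl AZ AN// -!scalemxAl zN// scaler0 subr0.
  by rewrite subrr.
by exists beta; rewrite -E addrC subrK.
Qed.

Let U := immersion_domain D X.

Let U_sub p : U p -> U0 p. Proof. by case. Qed.

Let oU : open U.
Proof.
have sJ := smooth_jacobian oU0 sX.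
have sg := smooth_det oU0 (smooth_mulmx oU0 sJ (smooth_trmx oU0 sJ)).
have := open_neq0 oU0 (sg 0%N).
rewrite (_ : [set _ | _] = U)//; apply/seteqP.
by split=> p [Up H]; split=> //; move: H;
  rewrite -gram_unit unitmxE unitfE.
Qed.

(** Otherwise the 2 + k rows of jacobian X would lie in the span of the k
    rulings. *)
Let mu_neq0 p (mu : R) (beta : 'M[R]_(2, k)) : U p ->
  A p = mu *: jacobian z (lsubmx p) + beta *m B (lsubmx p) -> mu != 0.
Proof.
move=> [Up Xf] AE; apply/eqP => mu0; move: Xf.
rewrite jacX// AE mu0 scale0r add0r.
have -> : col_mx (beta *m B (lsubmx p)) (B (lsubmx p))
    = col_mx beta 1%:M *m B (lsubmx p) by rewrite mul_col_mx mul1mx.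
rewrite /row_free => /eqP rk.
have := leq_trans (mxrankM_maxr (col_mx beta 1%:M) (B (lsubmx p)))
  (rank_leq_row _).
by rewrite rk -{2}[k]add0n leq_add2r.
Qed.

Let jacN p : U0 p -> jacobian (N \o lsubmx) p = col_mx (jacobian N (lsubmx p)) 0
  :> 'M[R]_(2 + k, d).
Proof.
move=> Up; have dN := diffD sN Up.
have dNl : differentiable (N \o lsubmx : 'rV[R]_(2 + k) -> _) p.
  exact: smooth_differentiable (smooth_lift sN) Up.
apply/row_matrixP => i; rewrite row_jacobian// (derive_lift _ sN Up).
rewrite deriveEjacobian// [RHS]rowE -[X in X *m col_mx _ _]hsubmxK mul_row_col.
by rewrite mulmx0 addr0.
Qed.

Let Nl (p : 'rV[R]_(2 + k)) := N (lsubmx p).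

Let sNl : smooth_on U Nl.
Proof. exact: smooth_subset U_sub (smooth_lift sN). Qed.

Let sXU : smooth_on U X.
Proof. exact: smooth_subset U_sub sX. Qed.

Lemma generated_patch : regular_patch U X.
Proof. by split=> // p []. Qed.

Lemma generated_normal : unit_normal (fun=> setT) U X Nl.
Proof.
split=> // p /U_sub Up; split=> //; first exact: NN.
by move=> v; apply/dot_eq0; rewrite -mulmxA XN// mulmx0.
Qed.

Let weingarten_z q : D q -> jacobian N q = - (shape_op z N q *m jacobian z q).
Proof.
move=> Dq; have [W WE] := weingarten_N Dq; rewrite WE -mulNmx; congr (_ *m _).
have Gu : G q \in unitmx by rewrite gram_unit; exact: zf.
rewrite /shape_op first_ffE; last exact: diffD sz Dq.
rewrite -(second_ff_sym N oD sz Dq) (second_ffE oD sz sN zN Dq).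
by rewrite linearN /= trmx_mul trmxK WE mulNmx opprK -(mulmxA W) mulmxK.
Qed.

Let s q := shape_op z N q.

Let det_s q : D q -> \det (s q) < 0.
Proof.
move=> Dq; have e := first_ffE (diffD sz Dq).
have tr0 := minimal Dq; rewrite /s /shape_op e in tr0 *.
apply: traceless_det_lt0 => //; first exact: zf.
  exact: second_ff_sym oD sz Dq.
exact: second_neq0.
Qed.

Let shape_block q (mu : R) (beta : 'M[R]_(2, k)) : 'M[R]_(2 + k) :=
  block_mx (mu^-1 *: s q) (- mu^-1 *: (s q *m beta)) 0 0.

(** The block matrix satisfies the Weingarten equation of X and its normal,
    which is constant along the rulings. *)
Lemma generated_shape_op p mu beta : U p ->
  A p = mu *: jacobian z (lsubmx p) + beta *m B (lsubmx p) ->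
  shape_op X Nl p = shape_block (lsubmx p) mu beta.
Proof.
move=> Up AE; have Up0 := U_sub Up; have [_ Xf] := Up.
have mu0 := mu_neq0 Up AE.
have XNU y : U y -> jacobian X y *m (Nl y)^T = 0 by move=> /U_sub; exact: XN.
have SX : shape_block (lsubmx p) mu beta *m jacobian X p = - jacobian Nl p.
  rewrite jacX// jacN// /shape_block mul_block_col !mul0mx addr0 AE weingarten_z//.
  rewrite opp_col_mx opprK oppr0; congr col_mx.
  rewrite mulmxDr -!scalemxAl -scalemxAr scalerA mulVf// scale1r -addrA mulmxA.
  by rewrite scaleNr addrN addr0.
rewrite /shape_op first_ffE; last exact: smooth_differentiable sXU Up.
rewrite -(second_ff_sym Nl oU sXU Up) (second_ffE oU sXU sNl XNU Up).
by rewrite linearN /= trmx_mul trmxK -mulNmx -SX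
  -(mulmxA (shape_block _ _ _)) mulmxK// gram_unit.
Qed.

Lemma generated_type_two p mu beta : U p ->
  A p = mu *: jacobian z (lsubmx p) + beta *m B (lsubmx p) ->
  exists nu1 nu2, type_two_eigenvalues (shape_op X Nl p) nu1 nu2.
Proof.
move=> Up AE; rewrite (generated_shape_op Up AE); have Up0 := U_sub Up.
have mu0 := mu_neq0 Up AE.
have tr0 : \tr (mu^-1 *: s (lsubmx p)) = 0.
  by rewrite mxtraceZ minimal// mulr0.
have det0 : \det (mu^-1 *: s (lsubmx p)) < 0.
  by rewrite detZ pmulr_rlt0 ?det_s// exprn_even_gt0// invr_neq0.
have r0 : Num.sqrt (- \det (mu^-1 *: s (lsubmx p))) != 0.
  by rewrite gt_eqF// sqrtr_gt0 oppr_gt0.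
set r := Num.sqrt _ in r0; exists r, (- r); split; rewrite ?oppr_eq0//.
by rewrite char_poly_block0 char_poly_traceless// addKn.
Qed.

Lemma generated_trace p : U p -> \tr (shape_op X Nl p) = 0.
Proof.
move=> Up; have Up0 := U_sub Up; have [mu [beta AE]] := A_decomposition Up0.
rewrite (generated_shape_op Up AE) mxtrace_block mxtraceZ minimal// mulr0.
by rewrite mxtrace0 addr0.
Qed.

(** The block s is invertible, so the kernel of the shape operator consists of
    the rulings. *)
Let DeltaE p v : U p ->
  Delta X Nl p v <-> v *m jacobian X p *m (B (lsubmx p))^T = 0.
Proof.
move=> Up; have Up0 := U_sub Up; have [mu [beta AE]] := A_decomposition Up0.
have mu0 := mu_neq0 Up AE; have SE := generated_shape_op Up AE.
split=> [Dv|vB w wS].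
  apply/matrixP => i j; rewrite ord1 mulmx_tr_dot row_id [RHS]mxE.
  have := Dv (row_mx 0 (delta_mx 0 j)); rewrite SE mul_row_block !mul0mx.
  rewrite !mulmx0 !addr0 row_mx0 => /(_ erefl).
  by rewrite jacX// mul_row_col mul0mx add0r -rowE.
have w0 : lsubmx w = 0.
  move: wS; rewrite SE -[w]hsubmxK mul_row_block !mulmx0 !addr0.
  rewrite -row_mx0 => /eq_row_mx[+ _]; rewrite row_mxKl -scalemxAr => /eqP.
  rewrite scaler_eq0 invr_eq0 (negbTE mu0) /= => /eqP.
  move/(congr1 (mulmx^~ (invmx (s (lsubmx p))))); rewrite mulmxK ?mul0mx//.
  by rewrite unitmxE unitfE lt_eqF// det_s.
apply/dot_eq0; rewrite -[w]hsubmxK w0 [in X in _ *m X]jacX// mul_row_col mul0mx.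
by rewrite add0r trmx_mul mulmxA vB mul0mx.
Qed.

Let sB : smooth_on D B.
Proof.
apply/smooth_mxP => // a j.
apply: (smooth_eq oD _ ((smooth_mxP _ oD).1 (sb a) 0 j)) => q _.
by rewrite mxE.
Qed.

Let row_derive_B a q u : D q -> row a ('D_u B q) = u *m jacobian (b a) q.
Proof.
move=> Dq; rewrite -deriveEjacobian; last exact: diffD (sb a) Dq.
apply/rowP => j; rewrite mxE deriveE_mx; last exact: diffD sB Dq.
rewrite deriveE_mx; last exact: diffD (sb a) Dq.
by congr ('D_u _ q); apply/funext => y; rewrite mxE.
Qed.

(** Both sides pair l1 and l2 through <z_i, d_j b>, which is a multiple of the
    symmetric G. *)
Let derive_B_sym q (l1 l2 : 'rV[R]_2) : D q ->
  l1 *m jacobian z q *m ('D_l2 B q)^T = l2 *m jacobian z q *m ('D_l1 B q)^T.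
Proof.
move=> Dq.
suff gen (B1 B2 : 'M[R]_(k, d)) :
    (forall a, row a B1 = l1 *m jacobian (b a) q) ->
    (forall a, row a B2 = l2 *m jacobian (b a) q) ->
    l1 *m jacobian z q *m B2^T = l2 *m jacobian z q *m B1^T.
  by apply: gen => a; exact: row_derive_B.
move=> B1E B2E; apply/matrixP => i a.
rewrite ord1 !mulmx_tr_dot !row_id B1E B2E; have [t tE] := jb_Z a Dq.
have tE' : jacobian z q *m (jacobian (b a) q)^T = t *: G q.
  by rewrite -[LHS]trmxK trmx_mul trmxK tE linearZ /= GT.
have e (u v : 'rV[R]_2) : dot (u *m jacobian z q) (v *m jacobian (b a) q)
    = (t *: (u *m G q *m v^T)) 0 0.
  by rewrite dotE trmx_mul mulmxA -(mulmxA u) tE' -scalemxAr -scalemxAl.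
rewrite !e; have -> : l1 *m G q *m l2^T = (l2 *m G q *m l1^T)^T.
  by rewrite trmx_mul (trmx_mul l2) trmxK GT mulmxA.
by rewrite [LHS]mxE [RHS]mxE [_^T _ _]mxE.
Qed.

(** For a field C in Delta, dX(C) is orthogonal to the rulings. Differentiate
    this for each field along the other one and subtract: the second
    derivatives of X cancel by symmetry, and the derivatives of the rulings
    cancel by derive_B_sym because dX(C) is mu times a vector tangent to the
    surface. *)
Lemma generated_involutive : involutive_on U (Delta X Nl).
Proof.
move=> O A1 A2 oO OU sA1 sA2 DA1 DA2 x Ox.
have Ux := OU x Ox; have Ux0 := U_sub Ux; apply/(DeltaE _ Ux).
have [mu [beta AE]] := A_decomposition Ux0.
pose Bl (p : 'rV[R]_(2 + k)) := B (lsubmx p).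
have dA1 := smooth_differentiable sA1 Ox.
have dA2 := smooth_differentiable sA2 Ox.
have dJ : differentiable (jacobian X) x.
  exact: smooth_differentiable (smooth_jacobian oU0 sX) Ux0.
have dB : differentiable Bl x.
  exact: smooth_differentiable (smooth_lift sB) Ux0.
have flat (C : 'rV[R]_(2 + k) -> 'rV[R]_(2 + k)) v : differentiable C x ->
    (forall y, O y -> Delta X Nl y (C y)) ->
    ('D_v C x *m jacobian X x + C x *m 'D_v (jacobian X) x) *m (Bl x)^T
      + C x *m jacobian X x *m ('D_v Bl x)^T = 0.
  move=> dC DC; have CB y : O y -> C y *m jacobian X y *m (Bl y)^T = 0.
    by move=> Oy; apply/(DeltaE _ (OU y Oy)); exact: DC.
  have E := etrans (esym (derive_mulmx3_tr v dC dJ dB)) (derive_eq_on v oO Ox CB).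
  by rewrite derive_cst in E.
have Y (C : 'rV[R]_(2 + k)) : Delta X Nl x C ->
    C *m jacobian X x = mu *: (lsubmx C *m jacobian z (lsubmx x)).
  move=> /(DeltaE _ Ux).
  have -> : C *m jacobian X x = mu *: (lsubmx C *m jacobian z (lsubmx x))
      + (lsubmx C *m beta + rsubmx C) *m B (lsubmx x).
    rewrite jacX// AE -[in LHS](hsubmxK C) mul_row_col mulmxDr mulmxDl.
    by rewrite -scalemxAr mulmxA addrA.
  move: (_ + rsubmx C) => w; rewrite mulmxDl -scalemxAl -(mulmxA (lsubmx C)).
  have -> : jacobian z (lsubmx x) *m (B (lsubmx x))^T = 0.
    by rewrite -[LHS]trmxK trmx_mul trmxK BZ// trmx0.
  rewrite mulmx0 scaler0 add0r -mulmxA => /(congr1 (mulmx^~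
    (invmx (B (lsubmx x) *m (B (lsubmx x))^T)))).
  by rewrite mulmxK ?gram_unit ?Bf// mul0mx => ->; rewrite mul0mx addr0.
have Bv v : 'D_v Bl x = 'D_(lsubmx v) B (lsubmx x) by exact: derive_lift sB Ux0.
have e1 := flat A1 (A2 x) dA1 DA1; have e2 := flat A2 (A1 x) dA2 DA2.
rewrite Y ?Bv -?scalemxAl in e1; last exact: DA1.
rewrite Y ?Bv -?scalemxAl in e2; last exact: DA2.
rewrite (derive_B_sym _ _ Ux0) in e1.
rewrite (derive_jacobian_sym _ _ oU0 sX Ux0) in e1.
rewrite /lie_bracket.
move: e1 e2; move: ('D_(A2 x) A1 x) ('D_(A1 x) A2 x) => P1 P2.
move=> e1 e2; have := congr2 (fun C C' => C - C') e2 e1.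
rewrite subr0 => <-; rewrite !mulmxDl !mulNmx.
by rewrite opprD addrACA subrr addr0 opprD addrACA subrr addr0.
Qed.

Lemma generates_minimal_K0_umbilic : generates_minimal_K0 D z b.
Proof.
exists Nl; split.
  split; last exact: generated_involutive.
  split; [exact: generated_patch|exact: generated_normal|].
  move=> p Up; have [mu [beta AE]] := A_decomposition (U_sub Up).
  exact: generated_type_two Up AE.
move=> p nu1 nu2 Up e; rewrite -(generated_trace Up).
by rewrite (type_two_trace _ e).
Qed.

End generated_hypersurface.

(** * Surfaces in affine spaces and in spheres *)

Section ambient.
Context {R : realType}.

Lemma derive_sub (V : normedModType R) k d (D : set V) (E : 'M[R]_(k, d))
    (f : V -> 'rV[R]_d) q v : row_free E -> open D -> D q ->
  differentiable f q -> (forall y, D y -> (f y <= E)%MS) ->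
  ('D_v f q <= E)%MS.
Proof.
move=> Ef oD Dq df fE; apply: sub_proj_row.
rewrite -derive_mulmxr//; apply: (derive_eq_on _ oD Dq) => y Dy.
by apply: proj_row_sub => //; exact: fE.
Qed.

Lemma sub_col_mx_orthogonal k l d p (F : 'M[R]_(k, d)) (y : 'M[R]_(l, d))
    (V : 'M[R]_(p, d)) : row_free y -> F *m y^T = 0 ->
  (V <= col_mx F y)%MS -> V *m y^T = 0 -> (V <= F)%MS.
Proof.
move=> yf Fy /submxP[C ->]; rewrite -[C]hsubmxK mul_row_col mulmxDl -!mulmxA Fy.
rewrite mulmx0 add0r => /(congr1 (mulmx^~ (invmx (y *m y^T)))).
by rewrite mulmxK ?gram_unit// mul0mx => ->; rewrite mul0mx addr0 submxMl.
Qed.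

Lemma sub_row_free_eq k d (F E : 'M[R]_(k, d)) : row_free F ->
  (F <= E)%MS -> (E <= F)%MS.
Proof.
move=> /eqP rF FE; rewrite -(mxrank_leqif_sup FE).2 eqn_leq.
by rewrite mxrankS// rF rank_leq_row.
Qed.

Lemma orthogonal_complement_basis_sub k l l' d (b : 'I_k -> 'rV[R]_d)
    (E : 'M[R]_(l, d)) (F : 'M[R]_(l', d)) : (E <= F)%MS -> (F <= E)%MS ->
  orthogonal_complement_basis b E -> orthogonal_complement_basis b F.
Proof.
move=> EF FE [bf bE]; split=> // v.
have dotP m (M : 'M[R]_(m, d)) : (forall i, dot v (row i M) = 0) <-> v *m M^T = 0.
  split=> [H|H i].
    by apply/matrixP => i j; rewrite ord1 mulmx_tr_dot row_id H mxE.
  by rewrite -[v in dot v _](row_id 0) -mulmx_tr_dot H mxE.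
have sub m m' (M : 'M[R]_(m, d)) (M' : 'M[R]_(m', d)) :
    (M <= M')%MS -> v *m M'^T = 0 -> v *m M^T = 0.
  by move=> /submxP[C ->] vM; rewrite trmx_mul mulmxA vM mul0mx.
split=> [/bE/dotP vE|/dotP vF]; first by apply/dotP; exact: sub FE vE.
by apply/bE/dotP; exact: sub EF vF.
Qed.

Lemma jacobian_sub k d (D : set 'rV[R]_2) (E : 'M[R]_(k, d)) (c : 'rV[R]_d)
    (f : 'rV[R]_2 -> 'rV[R]_d) q : row_free E -> open D -> D q ->
  smooth_on D f -> (forall y, D y -> (f y - c <= E)%MS) ->
  (jacobian f q <= E)%MS /\ forall i j, ('D_('e_j) ('D_('e_i) f) q <= E)%MS.
Proof.
move=> Ef oD Dq sf fE.
have Df v y : D y -> ('D_v f y <= E)%MS.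
  move=> Dy; have df := smooth_differentiable sf Dy.
  have <- : 'D_v (f - cst c) y = 'D_v f y.
    rewrite deriveB ?derive_cst ?subr0//; exact: diff_derivable.
  by apply: (derive_sub v Ef oD Dy _ fE); apply: differentiableB.
split=> [|i j].
  apply/row_subP => i; rewrite row_jacobian; last exact: smooth_differentiable Dq.
  exact: Df.
apply: (derive_sub _ Ef oD Dq) => [|y Dy]; last exact: Df.
exact: smooth_differentiable (smooth_derive 'e_i sf) Dq.
Qed.

Lemma unit_normal_setT d T (D : set 'rV[R]_2) (z N : 'rV[R]_2 -> 'rV[R]_d) :
  unit_normal T D z N -> unit_normal (fun=> setT) D z N.
Proof. by move=> [sN H]; split=> // q /H[]. Qed.

(** The second derivatives of z stay in E, so they have no component along the
    rulings: umbilicity holds with factor zero. *)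
Lemma generates_affine k d (D : set 'rV[R]_2) (z N : 'rV[R]_2 -> 'rV[R]_d)
    (c : 'rV[R]_d) (E : 'M[R]_(3, d)) (b : 'I_k -> 'rV[R]_d) :
  (forall q, D q -> second_ff z N q != 0) -> minimal_in_affine3 c E D z N ->
  orthogonal_complement_basis b E -> generates_minimal_K0 D z (fun a _ => b a).
Proof.
move=> h0 [Ef [rz zE uNE tr0]] bE.
have uN := unit_normal_setT uNE.
have [oD sz zf] := rz; have [sN HN] := uNE.
have NN q : D q -> dot (N q) (N q) = 1 by move=> /HN[].
have zN q : D q -> jacobian z q *m (N q)^T = 0.
  by move=> /HN[_ _]; exact: jacobian_normal0.
have Nf q : D q -> row_free (N q).
  by move=> Dq; apply: unit_row_free; exact: NN.
have NE q : D q -> (N q <= E)%MS by move=> /HN[].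
have Ff q : D q -> row_free (col_mx (jacobian z q) (N q)).
  by move=> Dq; apply: row_free_orthogonal; [exact: zf|exact: Nf|exact: zN].
have FE q : D q -> (col_mx (jacobian z q) (N q) <= E)%MS.
  move=> Dq; rewrite col_mx_sub NE// andbT.
  by have [] := jacobian_sub Ef oD Dq sz zE.
have EF q : D q -> (E <= col_mx (jacobian z q) (N q))%MS.
  by move=> Dq; apply: (@sub_row_free_eq 3); [exact: Ff|exact: FE].
apply: (generates_minimal_K0_umbilic (N := N)) => //.
- move=> q Dq; apply/submxP; apply: (sub_col_mx_orthogonal (Nf q Dq) (zN q Dq)).
    apply: submx_trans (EF q Dq).
    have NE0 y : D y -> (N y - 0 <= E)%MS by move=> /NE; rewrite subr0.
    by have [] := jacobian_sub Ef oD Dq sN NE0.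
  exact: normal_derivative0 oD sN NN Dq.
- by move=> a; exact: smooth_cst.
- by move=> q Dq; apply: (orthogonal_complement_basis_sub _ _ bE);
    [exact: EF|exact: FE].
move=> q a Dq; exists 0 => i j; rewrite mul0r.
have [_ /(_ i j)/submxP[w ->]] := jacobian_sub Ef oD Dq sz zE.
rewrite dotC; apply/dot_eq0; rewrite trmx_mul mulmxA.
have -> : b a *m E^T = 0; last by rewrite mul0mx.
apply/matrixP => x y; rewrite ord1 mulmx_tr_dot row_id mxE.
have [_ /(_ (b a))[H _]] := bE; apply: H.
have {1}-> : b a = row a (\matrix_(a < k) b a) by rewrite rowK.
exact: row_sub.
Qed.

(** E is spanned by the tangent plane, N and the radius z - c. Differentiating
    <z_i, z - c> = 0 shows that the radial component of the second derivatives
    is - G / r^2, which makes every normal direction orthogonal to N umbilic. *)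
Lemma generates_sphere k d (D : set 'rV[R]_2) (z N : 'rV[R]_2 -> 'rV[R]_d)
    (c : 'rV[R]_d) (E : 'M[R]_(4, d)) r (b : 'I_k -> 'rV[R]_2 -> 'rV[R]_d) :
  (forall q, D q -> second_ff z N q != 0) -> minimal_in_sphere3 c E r D z N ->
  (forall a, smooth_on D (b a)) ->
  (forall q, D q ->
     orthogonal_complement_basis (b^~ q) (col_mx (jacobian z q) (N q))) ->
  generates_minimal_K0 D z b.
Proof.
move=> h0 [Ef r0 [rz zE uNE tr0]] sb bF.
have uN := unit_normal_setT uNE.
have [oD sz zf] := rz; have [sN HN] := uNE.
have NN q : D q -> dot (N q) (N q) = 1 by move=> /HN[].
have zN q : D q -> jacobian z q *m (N q)^T = 0.
  by move=> /HN[_ _]; exact: jacobian_normal0.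
have Nf q : D q -> row_free (N q).
  by move=> Dq; apply: unit_row_free; exact: NN.
pose y q := z q - c.
have r20 : r ^+ 2 != 0 by rewrite sqrf_eq0 gt_eqF.
have yy q : D q -> dot (y q) (y q) = r ^+ 2 by move=> /zE[].
have yE q : D q -> (z q - c <= E)%MS by move=> /zE[].
have NE q : D q -> (N q <= E)%MS by move=> /HN[[]].
have Ny q : D q -> dot (N q) (y q) = 0 by move=> /HN[[]].
have yf q : D q -> row_free (y q).
  move=> Dq; rewrite -gram_unit (_ : _ *m _ = (r ^+ 2)%:M).
    by rewrite unitmxE det_scalar expr1 unitfE.
  by apply/matrixP => i j; rewrite !ord1 -dotE yy// mxE.
have dz q : D q -> differentiable z q by exact: smooth_differentiable.
have dN q : D q -> differentiable N q by exact: smooth_differentiable.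
have dy q : D q -> differentiable y q.
  by move=> Dq; apply: differentiableB => //; exact: dz.
have Dy q v : D q -> 'D_v y q = 'D_v z q.
  move=> Dq; rewrite deriveB ?derive_cst ?subr0//.
  exact/diff_derivable/dz.
have zy q v : D q -> dot ('D_v z q) (y q) = 0.
  move=> Dq; have E1 := etrans (esym (derive_dot v (dy q Dq) (dy q Dq)))
    (derive_eq_on v oD Dq yy).
  move: E1; rewrite derive_cst Dy// [dot (y q) _]dotC => /eqP.
  by rewrite -mulr2n mulrn_eq0 => /eqP.
have Zy q : D q -> jacobian z q *m (y q)^T = 0.
  move=> Dq; apply/matrixP => i j.
  by rewrite mulmx_tr_dot ord1 row_id row_jacobian ?zy ?mxE//; exact: dz.
have N'y q v : D q -> dot ('D_v N q) (y q) = 0.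
  move=> Dq; have E1 := etrans (esym (derive_dot v (dN q Dq) (dy q Dq)))
    (derive_eq_on v oD Dq Ny).
  move: E1; rewrite derive_cst Dy// => <-.
  have -> : dot (N q) ('D_v z q) = 0; last by rewrite addr0.
  rewrite dotC deriveEjacobian; last exact: dz.
  by apply/dot_eq0; rewrite -mulmxA zN// mulmx0.
have z''y q i j : D q -> dot ('D_('e_j) ('D_('e_i) z) q) (y q)
    = - (jacobian z q *m (jacobian z q)^T) i j.
  move=> Dq; have dz' : differentiable ('D_('e_i) z) q.
    exact: smooth_differentiable (smooth_derive 'e_i sz) Dq.
  have E1 := etrans (esym (derive_dot 'e_j dz' (dy q Dq)))
    (derive_eq_on 'e_j oD Dq (fun q => @zy q 'e_i)).
  move: E1; rewrite derive_cst Dy// => /eqP; rewrite addr_eq0 => /eqP ->.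
  by rewrite mulmx_tr_dot !row_jacobian//; exact: dz.
pose F q := col_mx (jacobian z q) (N q).
have Fy q : D q -> F q *m (y q)^T = 0.
  move=> Dq; rewrite mul_col_mx Zy//.
  have -> : N q *m (y q)^T = 0 by apply/dot_eq0; exact: Ny.
  exact: col_mx0.
have Ff q : D q -> row_free (F q).
  by move=> Dq; apply: row_free_orthogonal; [exact: zf|exact: Nf|exact: zN].
have EF q : D q -> (E <= col_mx (F q) (y q))%MS.
  move=> Dq; apply: (@sub_row_free_eq (2 + 1 + 1)).
    by apply: row_free_orthogonal; [exact: Ff|exact: yf|exact: Fy].
  rewrite !col_mx_sub NE// yE// !andbT.
  by have [] := jacobian_sub Ef oD Dq sz yE.
apply: (generates_minimal_K0_umbilic (N := N)) => //.
- move=> q Dq; apply/submxP; apply: (sub_col_mx_orthogonal (Nf q Dq) (zN q Dq)).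
    apply: (sub_col_mx_orthogonal (yf q Dq) (Fy q Dq)).
      apply: submx_trans (EF q Dq).
      have NE0 y' : D y' -> (N y' - 0 <= E)%MS by move=> /NE; rewrite subr0.
      by have [] := jacobian_sub Ef oD Dq sN NE0.
    apply/matrixP => i j.
    by rewrite mulmx_tr_dot ord1 row_id row_jacobian ?N'y ?mxE//; exact: dN.
  exact: normal_derivative0 oD sN NN Dq.
move=> q a Dq; exists (- dot (y q) (b a q) / r ^+ 2) => i j.
have [_ /(_ i j) z''E] := jacobian_sub Ef oD Dq sz yE.
have := submx_trans z''E (EF q Dq); have := z''y q i j Dq.
move: ('D_('e_j) ('D_('e_i) z) q) => w wy /submxP[C wE].
have bF0 : F q *m (b a q)^T = 0.
  have [_ /(_ (b a q))[H _]] := bF q Dq.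
  apply/matrixP => x x'; rewrite mulmx_tr_dot ord1 row_id mxE dotC; apply: H.
  have {1}-> : b a q = row a (\matrix_(a < k) b a q) by rewrite rowK.
  exact: row_sub.
have {wE} [C1 [t wE]] : exists (C1 : 'rV_(2 + 1)) t, w = C1 *m F q + t *: y q.
  exists (lsubmx C), (rsubmx C 0 0); rewrite wE -[C in LHS]hsubmxK mul_row_col.
  by rewrite {1}[rsubmx C]mx11_scalar mul_scalar_mx.
have dotF u : F q *m u^T = 0 -> dot (C1 *m F q) u = 0.
  by move=> Fu; apply/dot_eq0; rewrite -mulmxA Fu mulmx0.
move: wy; rewrite wE !(dotDl (C1 *m F q)) !dotZl !dotF ?Fy// !add0r yy// => e.
have -> : t = - (jacobian z q *m (jacobian z q)^T) i j / r ^+ 2.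
  by rewrite -e mulfK.
by field; rewrite gt_eqF.
Qed.

End ambient.

Theorem theorem3p2 (R : realType) (n : nat) (hn : (3 <= n)%N) :
  (forall (U : set 'rV[R]_n) (X N : 'rV[R]_n -> 'rV[R]_n.+1),
     class_K0 U X N -> minimal_type_two U X N ->
     forall (D : set 'rV[R]_2) (phi : 'rV[R]_2 -> 'rV[R]_n),
       connected D -> integral_surface U X N D phi ->
       (exists (c : 'rV[R]_n.+1) (E : 'M[R]_(3, n.+1))
               (Nu : 'rV[R]_2 -> 'rV[R]_n.+1),
          minimal_in_affine3 c E D (X \o phi) Nu) \/
       (exists (c : 'rV[R]_n.+1) (E : 'M[R]_(4, n.+1)) (r : R)
               (Nu : 'rV[R]_2 -> 'rV[R]_n.+1),
          minimal_in_sphere3 c E r D (X \o phi) Nu)) /\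
  (forall (D : set 'rV[R]_2) (z N : 'rV[R]_2 -> 'rV[R]_n.+1),
     (forall q, D q -> second_ff z N q != 0) ->
     (forall (c : 'rV[R]_n.+1) (E : 'M[R]_(3, n.+1))
             (b : 'I_(n - 2) -> 'rV[R]_n.+1),
        minimal_in_affine3 c E D z N ->
        orthonormal_family b -> orthogonal_complement_basis b E ->
        generates_minimal_K0 D z (fun a _ => b a)) /\
     (forall (c : 'rV[R]_n.+1) (E : 'M[R]_(4, n.+1)) (r : R)
             (b : 'I_(n - 2) -> 'rV[R]_2 -> 'rV[R]_n.+1),
        minimal_in_sphere3 c E r D z N ->
        (forall a, smooth_on D (b a)) ->
        (forall q, D q ->
           orthogonal_complement_basis (b^~ q) (col_mx (jacobian z q) (N q))) ->
        generates_minimal_K0 D z b)).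
Proof.
split=> [U X N [tX _] mX D phi cD iphi|D z N h0].
  have [[c [E H]]|[c [E [r H]]]] :=
    integral_surface_space_form hn tX mX cD iphi.
    by left; exists c, E, (N \o phi).
  by right; exists c, E, r, (N \o phi).
split=> [c E b zE _ bE|c E r b zE sb bF].
  exact: generates_affine h0 zE bE.
exact: generates_sphere h0 zE sb bF.
Qed.
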